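(* Let $\mathfrak{h}_3^{\mathbb{C}}\oplus\mathbb{R}=(0,0,0,0,f^{13}-f^{24},f^{14}+f^{23},0)$ be endowed with the metric $$g=f^1\odot f^1+r\,f^2\odot f^2+f^3\odot f^3+s\,f^4\odot f^4+E\,f^5\odot f^5+2F\,f^5\odot f^6+G\,f^6\odot f^6+f^7\odot f^7,$$ where $0<s\le r\le1$, $E,F,G\ge0$ and $EG-F^2>0$. Then there exists a purely coclosed $\mathrm{G}_2$-structure $\varphi$ on $\mathfrak{h}_3^{\mathbb{C}}\oplus\mathbb{R}$ such that $g_\varphi=g$ if and only if one of the following sets of conditions holds: (a) $r=s=1$ (and any choice of $E,F,G\ge0$ with $EG-F^2>0$); (b) $0<r=s<1$ with $F=0$ and $G=E\left(\frac{\sqrt{rs}+1}{\sqrt r+\sqrt s}\right)^2$; (c) $0<s<r\le1$ with $F=0$ and either $G=E\left(\frac{\sqrt{rs}+1}{\sqrt r+\sqrt s}\right)^2$ or $G=E\left(\frac{\sqrt{rs}-1}{\sqrt r-\sqrt s}\right)^2$.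
   Context: Lie algebras are real and described by the tuple $(\mathrm{d}f^1,\dots,\mathrm{d}f^7)$ for a basis $\{f^1,\dots,f^7\}$ of $\mathfrak{n}^*$, with $f^{ij}=f^i\wedge f^j$; $\mathrm{d}$ is the Chevalley-Eilenberg differential ($\mathrm{d}\alpha(x,y)=-\alpha([x,y])$ for $\alpha\in\mathfrak{n}^*$, extended as a graded derivation of $\Lambda^\bullet\mathfrak{n}^*$). $\mathfrak{h}_3^{\mathbb{C}}$ is the real Lie algebra underlying the complex Heisenberg Lie algebra. The symmetric product is $f^i\odot f^j=\frac12(f^i\otimes f^j+f^j\otimes f^i)$. A $\mathrm{G}_2$-structure on a $7$-dimensional real vector space $V$ is a $3$-form $\varphi\in\Lambda^3V^*$ such that $(v\lrcorner\varphi)\wedge(v\lrcorner\varphi)\wedge\varphi\neq0$ for all $v\in V\smallsetminus\{0\}$. It determines a unique inner product $g_\varphi$ and orientation, with volume form $\mathrm{vol}_\varphi$, such that $g_\varphi(v,w)\mathrm{vol}_\varphi=\frac16\,(v\lrcorner\varphi)\wedge(w\lrcorner\varphi)\wedge\varphi$; $*_\varphi$ is the corresponding Hodge operator. A $\mathrm{G}_2$-structure $\varphi$ on $\mathfrak{n}$ is purely coclosed if $\mathrm{d}*_\varphi\varphi=0$ and $\mathrm{d}\varphi\wedge\varphi=0$. *)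

(* Defs.v *)
From HB Require Import structures.
From mathcomp Require Import all_boot all_fingroup all_order all_algebra.
From mathcomp Require Import boolp classical_sets functions reals ring.
Set Implicit Arguments.
Unset Strict Implicit.
Unset Printing Implicit Defensive.
Import Order.TTheory GRing.Theory Num.Theory.
Local Open Scope ring_scope.

(** * Exterior forms on R^n

A [k]-tuple of vectors of [R^n] is the [k x n] matrix whose rows are these
vectors, so a map on [k]-tuples of vectors is a map on matrices.  Sums,
differences and equality of forms are those of functions. *)

Notation kform R n k := ('M[R]_(k, n) -> R).

(* [alpha] belongs to Lambda^k (R^n)^*; multilinearity is phrased as in
   [determinant_multilinear]. *)
Definition alternating (R : realType) (n k : nat) (alpha : kform R n k) : Prop :=
  (forall (A B C : 'M[R]_(k, n)) (i : 'I_k) (b c : R),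
      row i A = b *: row i B + c *: row i C ->
      row' i B = row' i A -> row' i C = row' i A ->
      alpha A = b * alpha B + c * alpha C) /\
  (forall (A : 'M[R]_(k, n)) (i j : 'I_k),
      i != j -> row i A = row j A -> alpha A = 0).

(* Normalised so that, for 1-forms, (a /\ b)(x, y) = a(x) b(y) - a(y) b(x). *)
Definition wedge (R : realType) (n p q : nat)
    (alpha : kform R n p) (beta : kform R n q) : kform R n (p + q) :=
  fun A : 'M[R]_(p + q, n) =>
    (p`! * q`!)%:R^-1 *
    \sum_(s : 'S_(p + q)) (-1) ^+ s * alpha (usubmx (row_perm s A))
                                    * beta (dsubmx (row_perm s A)).

Definition contract (R : realType) (n k : nat)
    (v : 'rV[R]_n) (alpha : kform R n k.+1) : kform R n k :=
  fun A : 'M[R]_(k, n) => alpha (col_mx v A : 'M[R]_(1 + k, n)).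

(** * Lie brackets and the Chevalley-Eilenberg differential *)

Definition lie_bracket (R : realType) (n : nat)
    (br : 'rV[R]_n -> 'rV[R]_n -> 'rV[R]_n) : Prop :=
  [/\ forall (a : R) (x y z : 'rV[R]_n), br (a *: x + y) z = a *: br x z + br y z,
      forall x y : 'rV[R]_n, br x y = - br y x &
      forall x y z : 'rV[R]_n, br x (br y z) + br y (br z x) + br z (br x y) = 0].

(* (d alpha)(x_0, .., x_k) is the sum over i < j of
   (-1)^(i+j) alpha([x_i, x_j], x_0, .., ^x_i, .., ^x_j, .., x_k).
   Row [j] is removed first; as i < j, the vector x_i is still row [i] of
   [row' j A], which is why [i] may range over ['I_k]. *)
Definition CE_diff (R : realType) (n k : nat)
    (br : 'rV[R]_n -> 'rV[R]_n -> 'rV[R]_n) (alpha : kform R n k) :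
    kform R n k.+1 :=
  match k return kform R n k -> kform R n k.+1 with
  | 0 => fun _ _ => 0
  | m.+1 => fun alpha (A : 'M[R]_(m.+2, n)) =>
      \sum_(j < m.+2) \sum_(i < m.+1 | (i < j)%N)
        (-1) ^+ (i + j) *
        alpha (col_mx (br (row i (row' j A)) (row j A))
                      (row' i (row' j A)) : 'M[R]_(1 + m, n))
  end alpha.

(* The bracket on R^n, with dual basis f^1, .., f^n, for which d f^k is the
   2-form [df k], i.e. f^k([x, y]) = - (df k)(x, y). *)
Definition bracket_of (R : realType) (n : nat) (df : 'I_n -> kform R n 2) :
    'rV[R]_n -> 'rV[R]_n -> 'rV[R]_n :=
  fun x y => - \row_k df k (col_mx x y : 'M[R]_(1 + 1, n)).

(** * Inner products, volume forms and the Hodge operator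

An inner product on R^n is represented by its Gram matrix in the standard
basis. *)

Definition ip (R : realType) (n : nat) (g : 'M[R]_n) (v w : 'rV[R]_n) : R :=
  (v *m g *m w^T) 0 0.

Definition inner_product (R : realType) (n : nat) (g : 'M[R]_n) : Prop :=
  g^T = g /\ forall v : 'rV[R]_n, v != 0 -> 0 < ip g v v.

(* The orientation [o] says whether the standard basis of R^n is negatively
   oriented.  Note that [fun A => \det A] is the form f^1 /\ .. /\ f^n. *)
Definition vol (R : realType) (n : nat) (g : 'M[R]_n) (o : bool) : kform R n n :=
  fun A : 'M[R]_n => (-1) ^+ o * Num.sqrt (\det g) * \det A.

(* The coordinate expression of the Hodge operator: with e_1, .., e_n the
   standard basis and e^i = \sum_j g^(ij) e_j its reciprocal basis,
   ( *beta)(W) = 1/p! \sum beta(e^(i_1), .., e^(i_p)) vol(e_(i_1), .., e_(i_p), W),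
   the sum being over all (i_1, .., i_p).  This is the convention
   alpha /\ *beta = g(alpha, beta) vol for p-forms alpha and beta. *)
Definition hodge (R : realType) (p q : nat) (g : 'M[R]_(p + q)) (o : bool)
    (beta : kform R (p + q) p) : kform R (p + q) q :=
  fun W : 'M[R]_(q, p + q) =>
    p`!%:R^-1 *
    \sum_(i : {ffun 'I_p -> 'I_(p + q)})
      beta (rowsub i (invmx g)) * vol g o (col_mx (rowsub i 1%:M) W).

(** * G2-structures on R^7 *)

Definition G2_structure (R : realType) (phi : kform R 7 3) : Prop :=
  alternating phi /\
  forall v : 'rV[R]_7, v != 0 ->
    wedge (wedge (contract v phi) (contract v phi)) phi <> 0.

Definition G2_compatible (R : realType) (phi : kform R 7 3)
    (go : 'M[R]_7 * bool) : Prop :=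
  inner_product go.1 /\
  forall (v w : 'rV[R]_7) (A : 'M[R]_7),
    ip go.1 v w * vol go.1 go.2 A =
    6%:R^-1 * wedge (wedge (contract v phi) (contract w phi)) phi A.

(* The inner product and the orientation determined by [phi]; the default value
   is irrelevant, and is not an inner product. *)
Definition G2_data (R : realType) (phi : kform R 7 3) : 'M[R]_7 * bool :=
  xget (0, false) [set go | G2_compatible phi go]%classic.

Definition G2_metric (R : realType) (phi : kform R 7 3) : 'M[R]_7 :=
  (G2_data phi).1.

Definition G2_hodge (R : realType) (phi : kform R 7 3) :
    kform R 7 3 -> kform R 7 4 :=
  @hodge R 3 4 (G2_data phi).1 (G2_data phi).2.

Definition purely_coclosed (R : realType)
    (br : 'rV[R]_7 -> 'rV[R]_7 -> 'rV[R]_7) (phi : kform R 7 3) : Prop :=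
  CE_diff br (G2_hodge phi phi) = 0 /\ wedge (CE_diff br phi) phi = 0.

(** * The Lie algebra h_3^C + R and its metrics *)

(* f^k for 1 <= k <= 7: the indices are those of the mathematical notation,
   shifted by one with respect to ['I_7]. *)
Definition dual_basis (R : realType) (k : nat) : kform R 7 1 :=
  fun x : 'rV[R]_7 => x 0 (inord k.-1).

Definition dual_basis2 (R : realType) (i j : nat) : kform R 7 2 :=
  wedge (@dual_basis R i) (@dual_basis R j).

(* The tuple (0, 0, 0, 0, f^13 - f^24, f^14 + f^23, 0). *)
Definition df_h3C_R (R : realType) (k : 'I_7) : kform R 7 2 :=
  let ff := @dual_basis2 R in
  nth (0 : kform R 7 2) [:: 0; 0; 0; 0; ff 1%N 3%N - ff 2%N 4%N; ff 1%N 4%N + ff 2%N 3%N; 0] k.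

Definition h3C_R (R : realType) : 'rV[R]_7 -> 'rV[R]_7 -> 'rV[R]_7 :=
  bracket_of (@df_h3C_R R).

(* The Gram matrix of f^i (.) f^j = (f^i (x) f^j + f^j (x) f^i) / 2. *)
Definition sym_prod (R : realType) (i j : nat) : 'M[R]_7 :=
  2%:R^-1 *: (delta_mx (inord i.-1) (inord j.-1) +
              delta_mx (inord j.-1) (inord i.-1)).

Definition h3C_R_metric (R : realType) (r s E F G : R) : 'M[R]_7 :=
  let sp := @sym_prod R in
  sp 1%N 1%N + r *: sp 2%N 2%N + sp 3%N 3%N + s *: sp 4%N 4%N +
  E *: sp 5%N 5%N + (2%:R * F) *: sp 5%N 6%N + G *: sp 6%N 6%N + sp 7%N 7%N.

(** * Consistency of the definitions *)

Lemma inner_product_det_gt0 (R : realType) (n : nat) (g : 'M[R]_n) :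
  inner_product g -> 0 < \det g.
Proof.
move=> [_ gP].
pose p : {poly R} := \det (map_mx polyC (1%:M : 'M[R]_n) + 'X *: map_mx polyC (g - 1%:M)).
have pE t : p.[t] = \det (1%:M + t *: (g - 1%:M)).
  rewrite /p -horner_evalE -det_map_mx; congr (\det _).
  by apply/matrixP=> i j; rewrite !mxE /= horner_evalE !hornerE.
have pN0 t : 0 <= t <= 1 -> p.[t] != 0.
  move=> /andP[t0 t1]; rewrite pE; apply/negP => /det0P [v v0 vg].
  have : (v *m (1%:M + t *: (g - 1%:M)) *m v^T) 0 0 = 0 by rewrite vg mul0mx mxE.
  have -> : 1%:M + t *: (g - 1%:M) = (1 - t) *: 1%:M + t *: g.
    by rewrite scalerBr scalerBl scale1r addrA addrAC.
  rewrite mulmxDr mulmxDl -!scalemxAr -!scalemxAl mulmx1 mxE mxE [X in _ + X]mxE.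
  have v2 : 0 < (v *m v^T) 0 0.
    rewrite mxE; under eq_bigr do rewrite mxE -expr2.
    rewrite lt_neqAle sumr_ge0 ?andbT; last by move=> i _; exact: sqr_ge0.
    apply: contraNneq v0 => /esym/eqP.
    rewrite psumr_eq0; last by move=> i _; exact: sqr_ge0.
    move=> /allP h; apply/eqP/rowP=> i; rewrite mxE; apply/eqP.
    by have := h i (mem_index_enum i); rewrite /= sqrf_eq0.
  have := gP v v0; rewrite /ip => vgv; apply/eqP; rewrite gt_eqF //.
  have [->|tn0] := eqVneq t 0; first by rewrite subr0 mul1r mul0r addr0.
  have tp : 0 < t by rewrite lt_def tn0.
  by rewrite ltr_wpDl ?(mulr_gt0 tp) // mulr_ge0 ?subr_ge0 // ltW.
have p0 : p.[0] = 1 by rewrite pE scale0r addr0 det1.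
have p1 : p.[1] = \det g by rewrite pE scale1r addrC subrK.
rewrite -p1 ltNge; apply/negP => p1le.
have [] := @poly_ivt R (- p) 0 1 ler01; first by rewrite !hornerN p0 oppr_le0 ler01 oppr_ge0.
move=> t t01; rewrite rootE hornerN oppr_eq0; apply/negP; exact: pN0.
Qed.

Lemma expr_odd_inj (R : realType) (k : nat) (x y : R) :
  odd k -> x ^+ k = y ^+ k -> x = y.
Proof.
move=> ko e; have k0 : (0 < k)%N by case: k ko {e}.
case: (lerP 0 x) (lerP 0 y) => [x0|x0] [y0|y0].
- by apply/eqP; rewrite -(eqrXn2 k0) // e.
- have: x ^+ k < 0 by rewrite e exprn_odd_lt0.
  by rewrite ltNge exprn_ge0.
- have: y ^+ k < 0 by rewrite -e exprn_odd_lt0.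
  by rewrite ltNge exprn_ge0.
- by apply/oppr_inj/eqP; rewrite -(eqrXn2 k0) ?oppr_ge0 ?ltW // (exprNn x) (exprNn y) e.
Qed.

Lemma G2_compatible_unique (R : realType) (phi : kform R 7 3)
    (go go' : 'M[R]_7 * bool) :
  G2_compatible phi go -> G2_compatible phi go' -> go = go'.
Proof.
case: go go' => [g o] [g' o'] [/= gI gE] [/= gI' gE'].
have dg := inner_product_det_gt0 gI; have dg' := inner_product_det_gt0 gI'.
pose c := (-1) ^+ o * Num.sqrt (\det g); pose c' := (-1) ^+ o' * Num.sqrt (\det g').
have c0 : c != 0 by rewrite mulf_neq0 ?signr_eq0 // gt_eqF ?sqrtr_gt0.
have c'0 : c' != 0 by rewrite mulf_neq0 ?signr_eq0 // gt_eqF ?sqrtr_gt0.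
have c2 : c ^+ 2 = \det g by rewrite exprMn sqrr_sign mul1r sqr_sqrtr ?ltW.
have c2' : c' ^+ 2 = \det g' by rewrite exprMn sqrr_sign mul1r sqr_sqrtr ?ltW.
have ipE (h : 'M[R]_7) i j : ip h (delta_mx 0 i) (delta_mx 0 j) = h i j.
  by rewrite /ip trmx_delta -rowE -colE !mxE.
have cg : c *: g = c' *: g'.
  apply/matrixP=> i j; have := gE (delta_mx 0 i) (delta_mx 0 j) 1%:M.
  rewrite -gE' !ipE /vol det1 !mulr1 !mxE -/c -/c' => h.
  by rewrite mulrC h mulrC.
have : c ^+ 9 = c' ^+ 9.
  have := congr1 determinant cg.
  by rewrite !detZ -c2 -c2' -!exprD.
move=> /(expr_odd_inj (isT : odd 9)) cc; have gg : g = g'.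
  by apply: (scalerI c0); rewrite cg cc.
congr (_, _) => //; move: cc; rewrite /c /c' gg => /mulIf.
rewrite gt_eqF ?sqrtr_gt0 // => /(_ isT).
exact: signr_inj.
Qed.

Lemma G2_data_eq (R : realType) (phi : kform R 7 3) (go : 'M[R]_7 * bool) :
  G2_compatible phi go -> G2_data phi = go.
Proof.
by move=> h; apply: xget_unique => // go' h'; exact: G2_compatible_unique h' h.
Qed.

Lemma wedge11E (R : realType) (n : nat) (a b : kform R n 1) (A : 'M[R]_(1 + 1, n)) :
  wedge a b A = a (row 0 A) * b (row 1 A) - a (row 1 A) * b (row 0 A).
Proof.
have us (s : 'S_2) : usubmx (row_perm s A : 'M_(1 + 1, n)) = row (s 0) A.
  by apply/rowP=> j; rewrite !mxE; congr (A (s _) _); exact: val_inj.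
have ds (s : 'S_2) : dsubmx (row_perm s A : 'M_(1 + 1, n)) = row (s 1) A.
  by apply/rowP=> j; rewrite !mxE; congr (A (s _) _); exact: val_inj.
have l01 : lift ord0 ord0 = 1 :> 'I_2 by exact: val_inj.
pose B : 'M[R]_2 := \matrix_(i, j) (if i == 0 then a else b) (row j A).
have -> : wedge a b A = \det B.
  rewrite /wedge /determinant invr1 mul1r; apply: eq_bigr => s _.
  by rewrite us ds big_ord_recl big_ord1 l01 !mxE /= mulrA.
rewrite (expand_det_row _ 0) big_ord_recl big_ord1 /cofactor l01 !det_mx11 !mxE /=.
have -> : lift ord0 0 = 1 :> 'I_2 by exact: val_inj.
have -> : lift 1 0 = 0 :> 'I_2 by exact: val_inj.
by rewrite !mul1r mulN1r mulrN.
Qed.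

Lemma dual_basisE (R : realType) (k : 'I_7) (x : 'rV[R]_7) :
  dual_basis k.+1 x = x 0 k.
Proof. by rewrite /dual_basis /= inord_val. Qed.

Lemma h3C_RE (R : realType) (x y : 'rV[R]_7) :
  let x_ k := x 0 (inord k) in let y_ k := y 0 (inord k) in
  h3C_R x y =
    - (x_ 0%N * y_ 2%N - y_ 0%N * x_ 2%N - (x_ 1%N * y_ 3%N - y_ 1%N * x_ 3%N))
      *: delta_mx 0 (inord 4)
    - (x_ 0%N * y_ 3%N - y_ 0%N * x_ 3%N + (x_ 1%N * y_ 2%N - y_ 1%N * x_ 2%N))
      *: delta_mx 0 (inord 5).
Proof.
move=> x_ y_.
have r0 : row 0 (col_mx x y : 'M[R]_(1 + 1, 7)) = x.
  by apply/rowP=> j; rewrite mxE -(col_mxEu x y 0 j); congr (col_mx x y _ _); exact: val_inj.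
have r1 : row 1 (col_mx x y : 'M[R]_(1 + 1, 7)) = y.
  by apply/rowP=> j; rewrite mxE -(col_mxEd x y 0 j); congr (col_mx x y _ _); exact: val_inj.
apply/rowP=> k; rewrite /h3C_R /bracket_of !mxE /df_h3C_R /dual_basis2.
case: k => [[|[|[|[|[|[|[|]]]]]]] kP] //=; rewrite ?fctE ?wedge11E ?r0 ?r1 /dual_basis /= -/(x_ _) -/(y_ _) -?val_eqE /= ?inordK //= ?mulr0 ?mulr1 ?subr0 ?oppr0 ?add0r //.
Qed.

Lemma h3C_R_lie_bracket (R : realType) : lie_bracket (h3C_R (R := R)).
Proof.
have h0 (x y : 'rV[R]_7) k : (k < 4)%N -> (h3C_R x y) 0 (inord k) = 0.
  move=> k4; rewrite h3C_RE !mxE -!val_eqE /= !inordK //; last exact: leq_trans k4 _.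
  by case: k k4 => [|[|[|[|]]]] //= _; rewrite !mulr0 subr0.
have z0 (x y z : 'rV[R]_7) : h3C_R x (h3C_R y z) = 0.
  by rewrite h3C_RE !h0 // !(mulr0, mul0r, subr0, addr0, oppr0, scale0r).
split=> [a x y z|x y|x y z]; last by rewrite !z0 !addr0.
- rewrite !h3C_RE !mxE; apply/rowP=> k; rewrite !mxE; ring.
- rewrite !h3C_RE; apply/rowP=> k; rewrite !mxE; ring.
Qed.

Lemma CE_diff_dual_basis (R : realType) (df : 'I_7 -> kform R 7 2) (k : 'I_7)
    (x y : 'rV[R]_7) :
  CE_diff (bracket_of df) (@dual_basis R k.+1) (col_mx x y : 'M[R]_(1 + 1, 7)) =
  df k (col_mx x y : 'M[R]_(1 + 1, 7)).
Proof.
rewrite /CE_diff !big_ord_recl big_ord0.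
rewrite big_pred0 // add0r addr0 big_mkcond big_ord1 /= expr1 mulN1r /dual_basis /= inord_val.
set u := bracket_of df _ _; set w := row' _ _.
have -> : (col_mx u w : 'M[R]_(1 + 0, 7)) 0 k = u 0 k.
  by rewrite -(col_mxEu u w 0 k); congr (col_mx u w _ _); exact: val_inj.
rewrite /u /bracket_of !mxE opprK; congr (df k (col_mx (m1 := 1) (m2 := 1) _ _)).
  apply/rowP=> j; rewrite -(col_mxEu x y 0 j) mxE mxE.
  by congr (fun_of_matrix (col_mx x y) _ _); exact: val_inj.
apply/rowP=> j; rewrite -(col_mxEd x y 0 j) mxE.
by congr (fun_of_matrix (col_mx x y) _ _); exact: val_inj.
Qed.

(* Main.v *)
Require Import Defs.
From HB Require Import structures.
From mathcomp Require Import all_boot all_fingroup all_order all_algebra.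
From mathcomp Require Import boolp classical_sets functions reals.
From mathcomp Require Import ring lra zify.
Set Implicit Arguments.
Unset Strict Implicit.
Unset Printing Implicit Defensive.
Import Order.TTheory GRing.Theory Num.Theory.
Local Open Scope ring_scope.

(** Work in a [g]-orthonormal frame [x_0, .., x_6] such that [x_0, .., x_3] span
[V = <e_1, .., e_4>], [x_4, x_5] span the derived algebra and [x_6 = e_7]; let
[z^i] be the covectors dual to [x_4, x_5, x_6].  Closedness of the Hodge dual of
[phi] kills the component of [phi] in [Lambda^3 V^*], so that
[phi = t z^456 + \sum_i z^jk /\ xi_i + \sum_i z^i /\ omega_i], with [xi_i] and
[omega_i] forms on [V].  Put [B(v, w) = i_v phi /\ i_w phi /\ phi], which is
[6 g(v, w) vol].  On [V] it involves only the [omega_i]: if [P] and [M] are the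
3x3 matrices of their self-dual and anti-self-dual parts, the equations are
[adj(P) M + P^T adj(M)^T = 0] and [\det P + \det M <> 0], and they force [P = 0]
or [M = 0].  Reversing [x_1] exchanges the two cases, so let [M = 0].  Then
[B(x_i, V) = 0] gives [xi_i = 0], [B(x_i, x_j) = 6 delta_ij vol] makes [P] a
multiple of an orthogonal matrix, and pure coclosedness says exactly that the
self-dual parts of [d z^4] and [d z^5] are orthogonal and of equal norm. *)

(** * Wedge products as shuffle sums *)

(** Two obstacles shape the development. A wedge product as defined is a sum over thousands of
    permutations, and B iterates it; sums over shuffles, with coefficients indexed by sorted lists,
    make every component a polynomial small enough for [ring]. The orientation determined by phi is
    not known in advance, so the value of vol on the frame is carried along as an unknown sign. The
    component of phi on V dies because it reappears in the differential of the Hodge dual multiplied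
    by d z^5, which is nondegenerate on V. The two equations on P and M are the trace-free part and
    the trace of B on V, since S^2_0 V is Lambda^+ tensor Lambda^-. With rho and sigma the square
    roots of r and s, the norm condition reads E (rho sigma + 1)^2 = G (rho + sigma)^2 once F = 0.
    Reversing x_1 replaces rho by - rho, whence the second formula for G. Case (a) is its degenerate
    instance sigma - rho = 0: the norm condition then forces rho = 1, both self-dual parts vanish,
    and E, F, G stay free. *)

Section Shuffle.
Variables (R : realType) (T : Type).
Implicit Types (a b : seq T -> R) (l : seq T).

(** Only lists of length [p] are constrained: the value of a form on a list of another length is
    meaningless. *)
Definition antisym (p : nat) a :=
  forall l1 l2 x y, (size l1 + size l2).+2 = p ->
    a (l1 ++ x :: y :: l2) = - a (l1 ++ y :: x :: l2).

Definition signed (b : bool) (x : R) := if b then - x else x.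

Lemma signedE (b : bool) (x : R) : signed b x = (-1) ^+ b * x.
Proof. by case: b; rewrite /= ?expr1 ?expr0 ?mulN1r ?mul1r. Qed.

Lemma antisym_cons p a x : antisym p.+1 a -> antisym p (a \o cons x).
Proof. by move=> ha l1 l2 y z e; apply: (ha (x :: l1)); rewrite /= addSn e. Qed.

Lemma antisym_front p a l1 l2 x : antisym p a -> (size l1 + size l2).+1 = p ->
  a (l1 ++ x :: l2) = (-1) ^+ size l1 * a (x :: l1 ++ l2).
Proof.
move=> ha; elim/last_ind: l1 l2 => [|l1 y IH] l2 /= sz; first by rewrite mul1r.
rewrite size_rcons -!cats1 -!catA /= in sz *.
rewrite ha; last by rewrite -sz addSn.
by rewrite IH /= ?addnS //; rewrite exprS mulN1r mulNr.
Qed.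

(* Meaningful only when [size l = p + q]. *)
Fixpoint shuffle l (p q : nat) a b : R :=
  if l is x :: l' then
    (if p is p'.+1 then shuffle l' p' q (a \o cons x) b else 0) +
    (if q is q'.+1 then signed (odd p) (shuffle l' p q' a (b \o cons x)) else 0)
  else a [::] * b [::].

(** Only sublists of [l] of the right lengths are ever evaluated. The predicate [Q] later becomes
    the bound [i < 7] on indices. *)
Lemma eq_shuffle (Q : pred T) l p q a a' b b' : size l = (p + q)%N -> all Q l ->
  (forall m, size m = p -> all Q m -> a m = a' m) ->
  (forall m, size m = q -> all Q m -> b m = b' m) ->
  shuffle l p q a b = shuffle l p q a' b'.
Proof.
elim: l p q a a' b b' => [|x l IH] [|p] [|q] a a' b b' //= sz; rewrite ?andbT.
- by move=> _ ea eb; rewrite ea ?eb.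
- move=> /andP[Qx Ql] ea eb; congr (_ + _); apply: IH => //; first by case: sz.
  by move=> m sm Qm; apply: eb => /=; rewrite ?sm ?Qx.
- move=> /andP[Qx Ql] ea eb; congr (_ + _); apply: IH => //; first by case: sz.
  by move=> m sm Qm; apply: ea => /=; rewrite ?sm ?Qx.
- move=> /andP[Qx Ql] ea eb; congr (_ + signed _ _); apply: IH => //; first by case: sz.
  + by move=> m sm Qm; apply: ea => /=; rewrite ?sm ?Qx.
  + by case: sz; rewrite addnS => ->; rewrite addSn.
  + by move=> m sm Qm; apply: eb => /=; rewrite ?sm ?Qx.
Qed.

Lemma signedZ (s : bool) (k y : R) : signed s (k * y) = k * signed s y.
Proof. by case: s; rewrite //= mulrN. Qed.

Lemma shuffleZr l p q a b (k : R) :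
  shuffle l p q a (fun t => k * b t) = k * shuffle l p q a b.
Proof.
elim: l p q a b => [|y l IH] p q a b /=; first by rewrite mulrCA.
rewrite mulrDr; congr (_ + _).
  by case: p => [|p]; rewrite ?mulr0 //; exact: IH.
by case: q => [|q]; rewrite ?mulr0 // -signedZ; congr (signed _ _); exact: IH.
Qed.

(** Indexing by [nat] lets [mkseq] describe the slots of either factor without casts between
    ordinals. *)
Definition perm_nat n (s : 'S_n) (i : nat) : nat :=
  if insub i is Some j then val (s j) else 0%N.

Lemma perm_natE n (s : 'S_n) (i : 'I_n) : perm_nat s i = s i.
Proof. by rewrite /perm_nat valK. Qed.

Variable x0 : T.

Definition wedge_sum n (p q : nat) a b l : R :=
  \sum_(s : 'S_n) (-1) ^+ s *
     a (mkseq (fun i => nth x0 l (perm_nat s i)) p) *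
     b (mkseq (fun i => nth x0 l (perm_nat s (p + i))) q).

Lemma lift_perm_bij n :
  bijective (fun ks : 'I_n.+1 * 'S_n => lift_perm ks.1 ord0 ks.2).
Proof.
apply: inj_card_bij; last by rewrite card_prod !card_Sn card_ord factS.
move=> [k s] [k' s'] /= e.
have ek : k = k'.
  apply: (@perm_inj _ (lift_perm k ord0 s)).
  by rewrite lift_perm_id e lift_perm_id.
subst k'; congr (_, _); apply/permP=> i; apply: (@lift_inj _ ord0).
by rewrite -(lift_perm_lift k) e lift_perm_lift.
Qed.

Lemma perm_nat_lift n (k : 'I_n.+1) (s : 'S_n) (i : nat) : (i <= n)%N ->
  perm_nat (lift_perm k ord0 s) i =
  if (i < k)%N then (perm_nat s i).+1 else if i == k then 0%N else (perm_nat s i.-1).+1.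
Proof.
move=> i_n; have -> : i = Ordinal (i_n : (i < n.+1)%N) by [].
set i' := Ordinal _; rewrite perm_natE.
case: (unliftP k i') => [j|] ei; last first.
  by rewrite ei lift_perm_id ltnn eqxx.
rewrite ei lift_perm_lift /= /bump leq0n add1n.
case: (leqP k j) => kj; rewrite ?add1n ?add0n /=; last by rewrite kj perm_natE.
by rewrite ltnNge (leq_trans kj) //= gtn_eqF ?ltnS // perm_natE.
Qed.

Lemma sqr1_cancel_mul (u s a b : R) : u * u = 1 -> u * s * (u * a) * b = s * a * b.
Proof. by move=> uu; rewrite -[RHS]mul1r -uu; ring. Qed.

Lemma sqr1_cancel_mulr (u v s a b : R) : u * u = 1 ->
  v * u * s * a * (u * b) = v * (s * a * b).
Proof. by move=> uu; rewrite -[RHS]mul1r -uu; ring. Qed.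

(* A permutation of 'I_n.+1 is [lift_perm k ord0 s], where [k] is the slot that
   receives the first entry [x]: the [p] slots of [a], then the [q] slots of [b]. *)
Lemma wedge_sum_recl n p q a b x l : (p + q = n.+1)%N ->
  antisym p a -> antisym q b -> size l = n ->
  wedge_sum n.+1 p q a b (x :: l) =
    p%:R * wedge_sum n p.-1 q (a \o cons x) b l +
    (-1) ^+ p * q%:R * wedge_sum n p q.-1 a (b \o cons x) l.
Proof.
move=> pq ha hb sl; rewrite /wedge_sum.
rewrite (reindex _ (onW_bij _ (lift_perm_bij n))) /=.
rewrite -(pair_bigA _ (fun k (s : 'S_n) => (-1) ^+ lift_perm k ord0 s *
     a (mkseq (fun i => nth x0 (x :: l) (perm_nat (lift_perm k ord0 s) i)) p) *
     b (mkseq (fun i => nth x0 (x :: l) (perm_nat (lift_perm k ord0 s) (p + i))) q))) /=.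
(* The slot [k] of [x] lies before the window of [m] slots starting at [d], inside it, or after
   it. *)
have seqE (k : 'I_n.+1) (s : 'S_n) m d : (m + d <= n.+1)%N ->
  mkseq (fun i => nth x0 (x :: l) (perm_nat (lift_perm k ord0 s) (d + i))) m =
  if (k < d)%N then mkseq (fun i => nth x0 l (perm_nat s (d.-1 + i))) m
  else if (k < d + m)%N then
    mkseq (fun i => nth x0 l (perm_nat s (d + i))) (k - d) ++ x ::
    mkseq (fun i => nth x0 l (perm_nat s (d + (k - d + i)))) (m.-1 - (k - d))
  else mkseq (fun i => nth x0 l (perm_nat s (d + i))) m.
  move=> mn; case: ltnP => [kd|dk].
    apply/eq_in_map => i; rewrite mem_iota add0n leq0n => im; rewrite perm_nat_lift; last by lia.
    rewrite ltnNge (leq_trans (ltnW kd)) ?leq_addr //= gtn_eqF ?ltn_addr //.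
    by case: d kd {mn} => // d; rewrite addSn.
  case: ltnP => [km|mk]; last first.
    apply/eq_in_map => i; rewrite mem_iota add0n leq0n => im; rewrite perm_nat_lift; last by lia.
    by rewrite ifT //; lia.
  apply: (@eq_from_nth _ x0) => [|i].
    by rewrite size_cat /= !size_mkseq; lia.
  rewrite size_mkseq => im; rewrite nth_mkseq // nth_cat size_mkseq perm_nat_lift; last by lia.
  case: (ltnP i (k - d)) => ik1.
    by rewrite ifT ?nth_mkseq //; lia.
  rewrite (_ : (d + i < k)%N = false); last by apply/negbTE; rewrite -leqNgt; lia.
  have [ik|ik] := eqVneq (d + i)%N k.
    by rewrite (_ : (i - (k - d))%N = 0%N) //; lia.
  case ej : (i - (k - d))%N => [|j]; first by move/eqP: ik; lia.
  by rewrite [RHS]/= nth_mkseq /=; [congr (nth _ _ (perm_nat _ _)); lia | lia].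
have mkD (F : nat -> T) u v : mkseq F u ++ mkseq (fun i => F (u + i)%N) v = mkseq F (u + v).
  by rewrite /mkseq iotaD map_cat add0n -[in RHS](addn0 u) iotaDl -map_comp addn0.
have cardp : #|[pred k : 'I_n.+1 | (k < p)%N]| = p.
  have pn : (p <= n.+1)%N by rewrite -pq leq_addr.
  rewrite -sum1_card (eq_bigl (fun k : 'I_n.+1 => (k < p)%N)) //.
  by rewrite (big_ord_narrow pn) sum1_card card_ord.
have cardq : #|[pred k : 'I_n.+1 | ~~ (k < p)%N]| = q.
  have := cardC [pred k : 'I_n.+1 | (k < p)%N].
  rewrite cardp card_ord -pq => /addnI e; rewrite -[RHS]e; exact: eq_card.
rewrite (bigID (fun k : 'I_n.+1 => (k < p)%N)) /=; congr (_ + _).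
  (* Moving [x] to the front of [a] costs (-1)^k, which cancels the sign of the lifted permutation:
     the [p] slots of [a] contribute equally. *)
  rewrite (eq_bigr (fun=> \sum_(s : 'S_n) (-1) ^+ s *
     (a \o cons x) (mkseq (fun i => nth x0 l (perm_nat s i)) p.-1) *
     b (mkseq (fun i => nth x0 l (perm_nat s (p.-1 + i))) q))); last first.
    move=> k kp; apply: eq_bigr => s _.
    rewrite (seqE k s q p) ?kp; last by lia.
    have e0 : (p + 0 <= n.+1)%N by lia.
    have := seqE k s p 0%N e0; rewrite ltn0 add0n kp => e1.
    rewrite [X in a X]e1 (antisym_front _ ha); last by rewrite !size_mkseq; lia.
    rewrite (mkD (fun i => nth x0 l (perm_nat s i))) size_mkseq subn0 subnKC; last by lia.
    rewrite odd_lift_perm addbF signr_addb signr_odd.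
    have uu : (-1) ^+ k * (-1) ^+ k = 1 :> R by rewrite -expr2 sqrr_sign.
    exact: sqr1_cancel_mul.
  by rewrite sumr_const cardp mulr_natl.
(* Within [b] the vector [x] crosses only k - p entries, so the factor (-1)^p survives. *)
rewrite (eq_bigr (fun=> (-1) ^+ p * \sum_(s : 'S_n) (-1) ^+ s *
     a (mkseq (fun i => nth x0 l (perm_nat s i)) p) *
     (b \o cons x) (mkseq (fun i => nth x0 l (perm_nat s (p + i))) q.-1))).
  by rewrite sumr_const cardq -[LHS]mulr_natl [LHS]mulrCA [LHS]mulrA.
move=> k; rewrite -leqNgt => pk; rewrite mulr_sumr; apply: eq_bigr => s _.
rewrite (seqE k s q p) ?ltnNge ?pk /=; last by lia.
have e0 : (p + 0 <= n.+1)%N by lia.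
have := seqE k s p 0%N e0; rewrite ltn0 add0n ltnNge pk /= => e1.
have kn := ltn_ord k.
rewrite [X in a X]e1 ifT; last by lia.
rewrite (antisym_front _ hb); last by rewrite !size_mkseq; lia.
rewrite (mkD (fun i => nth x0 l (perm_nat s (p + i)))) size_mkseq subnKC; last by lia.
rewrite odd_lift_perm addbF signr_addb signr_odd -[X in (-1) ^+ X](subnKC pk) exprD.
have uu : (-1) ^+ (k - p) * (-1) ^+ (k - p) = 1 :> R by rewrite -expr2 sqrr_sign.
exact: sqr1_cancel_mulr.
Qed.

(** The factors [p] and [q] produced at each step of the recursion build up the factorials, which
    cancel the normalisation of [wedge]. *)
Lemma wedge_sumE l p q a b : antisym p a -> antisym q b -> size l = (p + q)%N ->
  wedge_sum (p + q) p q a b l = (p`! * q`!)%:R * shuffle l p q a b.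
Proof.
elim: l p q a b => [|x l IH] p q a b ha hb sz.
  case: p q sz ha hb => [|p] [|q] //= _ _ _.
  rewrite /wedge_sum mul1r -[RHS]mul1r (bigD1 (1%g : 'S_0)) //= big1 ?addr0.
    by rewrite odd_perm1 expr0 mul1r mul1r.
  by move=> s /negP []; apply/eqP/permP => -[].
have : (p + q)%N = (size l).+1 by rewrite -sz.
case: p q ha hb sz => [|p] [|q] ha hb sz e //.
- rewrite e wedge_sum_recl //= !mul0r add0r expr0 mul1r add0r.
  have eq0 : size l = (0 + q)%N by case: sz.
  rewrite {1}eq0 IH //; last exact: antisym_cons.
  by rewrite [q.+1`!]factS !natrM [LHS]mulrA; congr (_ * _); rewrite [LHS]mulrCA.
- rewrite e wedge_sum_recl //= mulr0 mul0r !addr0.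
  have ep0 : size l = (p + 0)%N by case: sz.
  rewrite {1}ep0 IH //; last exact: antisym_cons.
  by rewrite [p.+1`!]factS !natrM [LHS]mulrA; congr (_ * _); rewrite [LHS]mulrA.
- rewrite e wedge_sum_recl //=.
  have e1 : size l = (p + q.+1)%N by case: sz.
  have e2 : size l = (p.+1 + q)%N by rewrite e1 addnS.
  rewrite {1}e1 IH //; last exact: antisym_cons.
  rewrite e2 IH //; last exact: antisym_cons.
  rewrite signedE -/(odd p.+1) signr_odd !factS !natrM.
  move: (shuffle _ _ _ _ _) (shuffle _ _ _ _ _) (_ ^+ _) => u v w; ring.
Qed.
End Shuffle.

(** * Forms evaluated on lists of vectors *)

Section Forms.
Variables (R : realType) (n : nat).
Implicit Types (l : seq 'rV[R]_n).

(** Lists of vectors keep the number of arguments out of the type; a list that is too short is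
    padded with zero vectors. *)
Definition rows k l : 'M[R]_(k, n) := \matrix_(i < k) nth 0 l i.

Definition ev k (alpha : kform R n k) l : R := alpha (rows k l).

Lemma row_rows k l (i : 'I_k) : row i (rows k l) = nth 0 l i.
Proof. by rewrite rowK. Qed.

Lemma rows_row k (A : 'M[R]_(k, n)) : rows k [seq row i A | i <- enum 'I_k] = A.
Proof.
by apply/row_matrixP=> i; rewrite row_rows (nth_map i) ?size_enum_ord // nth_ord_enum.
Qed.

Lemma rows_cons k v l : rows k.+1 (v :: l) = (col_mx v (rows k l) : 'M[R]_(1 + k, n)).
Proof.
apply/row_matrixP=> i; rewrite row_rows.
case: (split_ordP (i : 'I_(1 + k))) => j ->.
  by rewrite [RHS](rowKu j v (rows k l)) ord1 /=; apply/rowP=> c; rewrite mxE.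
by rewrite [RHS](rowKd j v (rows k l)) row_rows.
Qed.

Lemma row'_rows k l1 x y l2 (i : 'I_k) : i = size l1 :> nat ->
  row' i (rows k (l1 ++ x :: l2)) = row' i (rows k (l1 ++ y :: l2)).
Proof.
move=> ei; apply/row_matrixP=> j; apply/rowP=> c; rewrite !mxE !nth_cat -ei.
have : lift i j != i :> nat by rewrite eq_sym (neq_lift i j).
case: ltngtP => // lt_ _.
by rewrite (_ : (lift i j - i)%N = (lift i j - i).-1.+1) //; move: lt_; lia.
Qed.

Section Alternating.
Variables (k : nat) (alpha : kform R n k).
Hypothesis ha : alternating alpha.

Lemma ev_lin l1 l2 (b c : R) x y : (size l1 + size l2).+1 = k ->
  ev alpha (l1 ++ (b *: x + c *: y) :: l2) =
  b * ev alpha (l1 ++ x :: l2) + c * ev alpha (l1 ++ y :: l2).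
Proof.
move=> sz; have ik : (size l1 < k)%N by lia.
apply: (ha.1 _ _ _ (Ordinal ik)); rewrite ?row_rows ?nth_cat /= ?ltnn ?subnn //=.
- exact: row'_rows.
- exact: row'_rows.
Qed.

Lemma ev_add l1 l2 x y : (size l1 + size l2).+1 = k ->
  ev alpha (l1 ++ (x + y) :: l2) = ev alpha (l1 ++ x :: l2) + ev alpha (l1 ++ y :: l2).
Proof. by move=> /(ev_lin 1 1 x y); rewrite !scale1r !mul1r. Qed.

Lemma ev_scale l1 l2 (b : R) x : (size l1 + size l2).+1 = k ->
  ev alpha (l1 ++ (b *: x) :: l2) = b * ev alpha (l1 ++ x :: l2).
Proof. by move=> /(ev_lin b 0 x 0); rewrite !scale0r !mul0r !addr0. Qed.

Lemma ev_sum l1 l2 (I : Type) (r : seq I) (b : I -> R) (x : I -> 'rV[R]_n) :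
  (size l1 + size l2).+1 = k ->
  ev alpha (l1 ++ (\sum_(i <- r) b i *: x i) :: l2) =
  \sum_(i <- r) b i * ev alpha (l1 ++ x i :: l2).
Proof.
move=> sz; elim: r => [|i r IH].
  by rewrite !big_nil -(scale0r 0) ev_scale // mul0r.
by rewrite !big_cons -[X in _ + X]scale1r ev_lin // mul1r IH.
Qed.

Lemma ev_dup l1 l2 x : (size l1 + size l2).+2 = k -> ev alpha (l1 ++ x :: x :: l2) = 0.
Proof.
move=> sz; have ik : (size l1 < k)%N by lia.
have jk : ((size l1).+1 < k)%N by lia.
apply: (ha.2 _ (Ordinal ik) (Ordinal jk)).
  by rewrite -val_eqE /= ltn_eqF.
by rewrite !row_rows !nth_cat /= ltnn subnn ltnNge leqnSn /= subSnn.
Qed.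

Lemma ev_antisym : antisym k (ev alpha).
Proof.
move=> l1 l2 x y sz.
have e : (size l1 + size (y :: l2)).+1 = k by rewrite -sz /= addnS.
have e' z : (size (rcons l1 z) + size l2).+1 = k by rewrite size_rcons -sz addSn.
have := ev_dup (x + y) sz.
rewrite ev_add /=; last by rewrite /= addnS.
rewrite -!(cat_rcons _ l1) !ev_add // !cat_rcons !ev_dup // add0r addr0.
by move/eqP; rewrite addr_eq0 => /eqP.
Qed.

End Alternating.

Lemma ev_contract k v (alpha : kform R n k.+1) l :
  ev (contract v alpha) l = ev alpha (v :: l).
Proof. by rewrite /ev /contract rows_cons. Qed.

Lemma row'_lift_col_mx k (v : 'rV[R]_n) (A : 'M[R]_(k.+1, n)) (i : 'I_k.+1) :
  row' (lift ord0 i) (col_mx v A : 'M[R]_(1 + k.+1, n)) =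
  (col_mx v (row' i A) : 'M[R]_(1 + k, n)).
Proof.
apply/matrixP=> j c; rewrite mxE.
case: (split_ordP (j : 'I_(1 + k))) => u ->.
  rewrite (_ : lift _ _ = lshift k.+1 u); last by apply: val_inj; rewrite /= ord1.
  by rewrite [RHS](col_mxEu v _ u) (col_mxEu v A u).
rewrite (_ : lift _ _ = rshift 1 (lift i u)); last first.
  by apply: val_inj; rewrite /= /bump /=; lia.
by rewrite [RHS](col_mxEd v _ u) (col_mxEd v A) [RHS]mxE.
Qed.

Lemma alternating_contract k v (alpha : kform R n k.+1) :
  alternating alpha -> alternating (contract v alpha).
Proof.
move=> [h1 h2]; split=> [|A i j ij eA].
  case: k alpha h1 {h2} => [|m] beta h1 A B C i b c eA eB eC; first by have := ltn_ord i.
  apply: (h1 _ _ _ (lift ord0 i)).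
  - have e (D : 'M[R]_(m.+1, n)) : row (lift ord0 i) (col_mx v D : 'M[R]_(1 + m.+1, n)) = row i D.
      rewrite (_ : lift ord0 i = rshift 1 i); last exact: val_inj.
      exact: (rowKd i).
    by rewrite !e.
  - by rewrite !row'_lift_col_mx eB.
  - by rewrite !row'_lift_col_mx eC.
apply: (h2 _ (rshift 1 i) (rshift 1 j)); first by apply: contra_neq ij => /(congr1 val) /= /addnI /val_inj.
by rewrite (etrans (rowKd i v A) (etrans eA (esym (rowKd j v A)))).
Qed.

Lemma alternating0 k : alternating (0 : kform R n k).
Proof. by split=> [A B C i b c _ _ _|A i j _ _]; rewrite ?fctE ?mulr0 ?addr0. Qed.

Lemma alternatingD k (alpha beta : kform R n k) :
  alternating alpha -> alternating beta -> alternating (alpha + beta).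
Proof.
move=> [a1 a2] [b1 b2]; split=> [A B C i b c eA eB eC|A i j ij eA]; rewrite !fctE.
  by rewrite (a1 A B C i b c) // (b1 A B C i b c) //; ring.
by rewrite (a2 A i j) // (b2 A i j) // addr0.
Qed.

Lemma alternatingZ k (a : R) (alpha : kform R n k) :
  alternating alpha -> alternating (fun A => a * alpha A).
Proof.
move=> [a1 a2]; split=> [A B C i b c eA eB eC|A i j ij eA].
  by rewrite (a1 A B C i b c) //; ring.
by rewrite (a2 A i j) // mulr0.
Qed.

Lemma alternatingB k (alpha beta : kform R n k) :
  alternating alpha -> alternating beta -> alternating (alpha - beta).
Proof.
move=> ha [b1 b2]; apply: alternatingD => //; split=> [A B C i b c eA eB eC|A i j ij eA].
  by rewrite !fctE (b1 A B C i b c) //; ring.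
by rewrite fctE (b2 A i j) // oppr0.
Qed.

Lemma alternating_linear (alpha : kform R n 1) :
  (forall (b c : R) x y, alpha (b *: x + c *: y) = b * alpha x + c * alpha y) ->
  alternating alpha.
Proof.
move=> h; split=> [A B C i b c|A i j]; last by rewrite !ord1 eqxx.
have e (D : 'rV[R]_n) : row 0 D = D by apply/rowP=> d; rewrite mxE.
by rewrite ord1 !e => -> _ _.
Qed.

Lemma lin_mul_mid (s b c x y z : R) :
  s * (b * x + c * y) * z = b * (s * x * z) + c * (s * y * z).
Proof. ring. Qed.

Lemma lin_mul_right (s b c x y z : R) :
  s * z * (b * x + c * y) = b * (s * z * x) + c * (s * z * y).
Proof. ring. Qed.

Section Wedge.
Variables (p q : nat) (alpha : kform R n p) (beta : kform R n q).
Hypotheses (ha : alternating alpha) (hb : alternating beta).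

Lemma wedge_shuffle l : size l = (p + q)%N ->
  ev (wedge alpha beta) l = shuffle l p q (ev alpha) (ev beta).
Proof.
move=> sl; rewrite /ev /wedge.
have f0 : (p`! * q`!)%:R != 0 :> R by rewrite pnatr_eq0 -lt0n muln_gt0 !fact_gt0.
apply: (mulfI f0); rewrite mulVKf //.
rewrite -(wedge_sumE 0 (ev_antisym ha) (ev_antisym hb) sl).
apply: eq_bigr => s _; congr (_ * alpha _ * beta _); apply/matrixP=> i c; rewrite !mxE nth_mkseq //.
  by rewrite -(perm_natE s (lshift q i)).
by rewrite -(perm_natE s (rshift p i)).
Qed.

Lemma alternating_wedge : alternating (wedge alpha beta).
Proof.
split=> [A B C i b c eA eB eC|A i j ij eA]; rewrite /wedge.
  rewrite !(mulrCA _ _^-1) -mulrDr; congr (_ * _).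
  rewrite !mulr_sumr -big_split /=; apply: eq_bigr => s _.
  have hE (D : 'M[R]_(p + q, n)) (k : 'I_(p + q)) d : row' i D = row' i A ->
    k != i -> D k d = A k d.
    move=> eD; case: (unliftP i k) => [m ->|->]; last by rewrite eqxx.
    by move=> _; have := congr1 (fun M : 'M_(_, _) => M m d) eD; rewrite !mxE.
  have iE d : A i d = b * B i d + c * C i d.
    by have := congr1 (fun M : 'rV_n => M 0 d) eA; rewrite !mxE.
  (* Row [i] lands in exactly one of the two factors, which is linear in it while the other does not
     see it. *)
  have [k|k] := split_ordP (s^-1 i)%g => si.
    have sk : s (lshift q k) = i by rewrite -si permKV.
    have dE (D : 'M[R]_(p + q, n)) : row' i D = row' i A ->
      dsubmx (row_perm s D) = dsubmx (row_perm s A).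
      move=> eD; apply/matrixP=> x y; rewrite !mxE hE // -sk (inj_eq perm_inj).
      by rewrite eq_rlshift.
    have uE (D : 'M[R]_(p + q, n)) : row' i D = row' i A ->
      row' k (usubmx (row_perm s D)) = row' k (usubmx (row_perm s A)).
      move=> eD; apply/matrixP=> x y; rewrite !mxE hE // -sk (inj_eq perm_inj).
      by rewrite (inj_eq (@lshift_inj _ _)) eq_sym neq_lift.
    rewrite (ha.1 _ (usubmx (row_perm s B)) (usubmx (row_perm s C)) k b c) ?uE //.
      rewrite !dE //; exact: lin_mul_mid.
    by apply/rowP=> x; rewrite !mxE sk.
  have sk : s (rshift p k) = i by rewrite -si permKV.
  have uE (D : 'M[R]_(p + q, n)) : row' i D = row' i A ->
    usubmx (row_perm s D) = usubmx (row_perm s A).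
    move=> eD; apply/matrixP=> x y; rewrite !mxE hE // -sk (inj_eq perm_inj).
    by rewrite eq_lrshift.
  have dE (D : 'M[R]_(p + q, n)) : row' i D = row' i A ->
    row' k (dsubmx (row_perm s D)) = row' k (dsubmx (row_perm s A)).
    move=> eD; apply/matrixP=> x y; rewrite !mxE hE // -sk (inj_eq perm_inj).
    by rewrite (inj_eq (@rshift_inj _ _)) eq_sym neq_lift.
  rewrite (hb.1 _ (dsubmx (row_perm s B)) (dsubmx (row_perm s C)) k b c) ?dE //.
    rewrite !uE //; exact: lin_mul_right.
  by apply/rowP=> x; rewrite !mxE sk.
(* Composing with the transposition of the two equal rows reverses every sign and leaves the
   permuted matrices unchanged. *)
set S := \sum_s _; suff : S = - S by move=> h; rewrite (_ : S = 0) ?mulr0 //; lra.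
rewrite {1}/S (reindex_inj (mulIg (tperm i j))) /S -sumrN; apply: eq_bigr => s _.
rewrite odd_permM odd_tperm ij signr_addb expr1 mulrN1 !mulNr.
rewrite (_ : row_perm (s * tperm i j)%g A = row_perm s A) //.
apply/matrixP=> x y; rewrite !mxE permM; case: tpermP => // ->.
  by have := congr1 (fun M : 'rV_n => M 0 y) eA; rewrite !mxE.
by have := congr1 (fun M : 'rV_n => M 0 y) eA; rewrite !mxE.
Qed.
End Wedge.
End Forms.

(** * Coefficients in a frame and the differential *)

(* [None] stands for a repeated index; otherwise the boolean is the parity of the
   number of transpositions.  The comparisons of [Nat] are used because they
   reduce under [cbv]. *)
Fixpoint insert (i : nat) (l : seq nat) : option (bool * seq nat) :=
  if l is j :: l' then
    if Nat.ltb i j then Some (false, i :: l)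
    else if Nat.eqb i j then None
    else if insert i l' is Some (b, m) then Some (negb b, j :: m) else None
  else Some (false, [:: i]).

Fixpoint alt_sort (l : seq nat) : option (bool * seq nat) :=
  if l is i :: l' then
    if alt_sort l' is Some (b, m) then
      if insert i m is Some (b', m') then Some (xorb b b', m') else None
    else None
  else Some (false, [::]).

Fixpoint combs (l : seq nat) (k : nat) : seq (seq nat) :=
  match l, k with
  | _, 0 => [:: [::]]
  | [::], _ => [::]
  | x :: l', k'.+1 => [seq x :: m | m <- combs l' k'] ++ combs l' k
  end.

Lemma ltbE (i j : nat) : Nat.ltb i j = (i < j)%N.
Proof. by rewrite /Nat.ltb; elim: i.+1 j => [|k IH] [|j] //=; rewrite IH. Qed.

Lemma eqbE (i j : nat) : Nat.eqb i j = (i == j).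
Proof. by elim: i j => [|i IH] [|j] //=. Qed.

Lemma insert_sorted i l b m : sorted ltn l -> insert i l = Some (b, m) ->
  sorted ltn m && perm_eq m (i :: l).
Proof.
elim: l b m => [|j l IH] b m /=; first by move=> _ [_ <-]; rewrite perm_refl.
rewrite ltbE eqbE; case: ltngtP => [ij|ji|//] sl.
  by move=> [_ <-]; rewrite /= ij sl perm_refl.
case E: insert => [[b' m']|//] [_ <-].
have /andP[sm pm] := IH _ _ (path_sorted sl) E.
apply/andP; split; last first.
  rewrite -(perm_cons j) in pm; apply: (perm_trans pm).
  exact: (permEl (perm_catCA [:: j] [:: i] l)).
rewrite /= path_min_sorted // (perm_all _ pm) /= ji.
exact: order_path_min ltn_trans sl.
Qed.

Lemma alt_sort_sorted l b m : alt_sort l = Some (b, m) -> sorted ltn m && perm_eq m l.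
Proof.
elim: l b m => [|i l IH] b m /=; first by move=> [_ <-].
case E: alt_sort => [[b' m']|//]; case F: insert => [[b2 m2]|//] [_ <-].
have /andP[sm pm] := IH _ _ E.
have /andP[sm2 pm2] := insert_sorted sm F.
by rewrite sm2 /= (perm_trans pm2) // perm_cons.
Qed.

Lemma mem_combs a n m : sorted ltn m -> all (fun i => a <= i < a + n)%N m ->
  m \in combs (iota a n) (size m).
Proof.
elim: n a m => [|n IH] a [|y m] //=; first by rewrite addn0; case: leqP.
- move=> ym /andP[/andP[ay yn] am]; rewrite mem_cat.
  have mlt := order_path_min ltn_trans ym.
  have [eya|nya] := eqVneq y a.
    rewrite -{}eya in am yn mlt *; rewrite map_f //; apply: IH; first exact: path_sorted ym.
    apply/allP => i im; move: (allP am _ im) (allP mlt _ im) => /=; lia.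
  apply/orP; right; apply: (IH a.+1 (y :: m)) => //=.
  apply/andP; split; first by move: nya ay yn; lia.
  by apply/allP => i im; move: (allP am _ im) (allP mlt _ im) => /=; lia.
Qed.

Section Coefs.
Variable R : realType.
Implicit Types (c : seq nat -> R).

(** The antisymmetric extension of the values of [c] on increasing lists, in a form that evaluates
    by computation. *)
Definition sorted_coef c l : R :=
  if alt_sort l is Some (b, m) then signed b (c m) else 0.

Lemma antisym_dup p c l1 l2 x : antisym p c -> (size l1 + size l2).+2 = p ->
  c (l1 ++ x :: x :: l2) = 0 :> R.
Proof. by move=> hc /(hc _ _ x x); lra. Qed.

Lemma antisym_insert p c i m : antisym p c -> (size m).+1 = p ->
  c (i :: m) = if insert i m is Some (b, m') then signed b (c m') else 0.
Proof.
elim: m p c => [|j m IH] p c hc //= sz.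
rewrite ltbE eqbE; case: ltngtP => // [ji|->]; last first.
  exact: (antisym_dup (l1 := [::]) _ hc).
rewrite (hc [::]) //= -[c _]/((c \o cons j) (i :: m)) (IH p.-1); last by rewrite -sz.
  by case: insert => [[[] m']|] /=; rewrite ?opprK ?oppr0.
by apply: antisym_cons; case: p sz hc.
Qed.

Lemma sorted_coefE p c l : antisym p c -> size l = p -> c l = sorted_coef c l.
Proof.
rewrite /sorted_coef; elim: l p c => [|i l IH] p c hc //= sz.
rewrite -[c (i :: l)]/((c \o cons i) l) (IH p.-1); last by rewrite -sz.
  case E: alt_sort => [[b m]|//].
  have /andP[_ /perm_size pm] := alt_sort_sorted E.
  rewrite /= (antisym_insert _ hc); last by rewrite pm.
  case: insert => [[b' m']|]; last by case: b {E} => /=; rewrite ?oppr0.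
  by case: b b' {E} => [] [] //=; rewrite opprK.
by apply: antisym_cons; case: p sz hc.
Qed.

Lemma antisym_eq0 n p c : antisym p c ->
  (forall m, m \in combs (iota 0 n) p -> c m = 0) ->
  forall l, size l = p -> all (fun i => i < n)%N l -> c l = 0.
Proof.
move=> hc h l sl ln; rewrite (sorted_coefE hc sl) /sorted_coef.
case E: alt_sort => [[b m]|//]; have /andP[sm pm] := alt_sort_sorted E.
rewrite h ?signedE ?mulr0 // -sl -(perm_size pm); apply: mem_combs => //.
by rewrite (perm_all _ pm).
Qed.

Lemma sorted_coef_ext n p c c' : antisym p c ->
  (forall m, m \in combs (iota 0 n) p -> c m = c' m) ->
  forall l, size l = p -> all (fun i => i < n)%N l -> c l = sorted_coef c' l.
Proof.
move=> hc h l sl ln; rewrite (sorted_coefE hc sl) /sorted_coef.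
case E: alt_sort => [[b m]|//]; have /andP[sm pm] := alt_sort_sorted E.
rewrite h // -sl -(perm_size pm); apply: mem_combs => //.
by rewrite (perm_all _ pm).
Qed.

Lemma shuffle_map (S T : Type) (x : S -> T) l p q (a b : seq T -> R) :
  shuffle (map x l) p q a b = shuffle l p q (a \o map x) (b \o map x).
Proof.
elim: l p q a b => [|i l IH] [|p] [|q] a b //=; rewrite ?IH //.
Qed.
End Coefs.

Section Frame.
Variables (R : realType) (n : nat) (x : nat -> 'rV[R]_n).

Definition coef k (alpha : kform R n k) (m : seq nat) : R := ev alpha (map x m).

Lemma coef_antisym k (alpha : kform R n k) : alternating alpha -> antisym k (coef alpha).
Proof.
by move=> ha l1 l2 i j sz; rewrite /coef !map_cat /= (ev_antisym ha) // !size_map.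
Qed.

Lemma coef_wedge p q (alpha : kform R n p) (beta : kform R n q) m :
  alternating alpha -> alternating beta -> size m = (p + q)%N ->
  coef (wedge alpha beta) m = shuffle m p q (coef alpha) (coef beta).
Proof. by move=> ha hb sm; rewrite /coef wedge_shuffle ?size_map // shuffle_map. Qed.

Lemma coef_contract k i (alpha : kform R n k.+1) m :
  coef (contract (x i) alpha) m = coef alpha (i :: m).
Proof. by rewrite /coef ev_contract. Qed.

Hypothesis x_span : forall v, exists b : 'I_n -> R, v = \sum_(i < n) b i *: x i.

Lemma alternating_eq0 k (alpha : kform R n k) : alternating alpha ->
  (forall m, m \in combs (iota 0 n) k -> coef alpha m = 0) -> alpha = 0.
Proof.
move=> ha h; apply/funext => A; rewrite -[A]rows_row -/(ev alpha _).
change (ev alpha [seq row i A | i <- enum (ordinal k)] = 0).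
have : size [seq row i A | i <- enum 'I_k] = k by rewrite size_map size_enum_ord.
move: [seq row i A | i <- enum 'I_k] => l.
(* Arguments are expanded in the frame one at a time from the right: [l1] holds those still
   arbitrary, [l2] the indices already chosen. *)
suff H l1 l2 : (size l1 + size l2)%N = k -> all (fun i => i < n)%N l2 ->
    ev alpha (l1 ++ map x l2) = 0.
  by move=> sl; rewrite -(cats0 l); apply: (H l [::]); rewrite ?addn0.
elim/last_ind: l1 l2 => [|l1 v IH] l2 sz ln.
  exact: (antisym_eq0 (coef_antisym ha) h).
have [b ->] := x_span v; rewrite size_rcons in sz.
rewrite cat_rcons ev_sum //; last by rewrite size_map.
rewrite big1 // => i _; rewrite -[x i :: _]/(map x (val i :: l2)) IH ?mulr0 //=.
  by rewrite addnS.
by rewrite ltn_ord.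
Qed.

Lemma alternating_ext k (alpha beta : kform R n k) :
  alternating alpha -> alternating beta ->
  (forall m, m \in combs (iota 0 n) k -> coef alpha m = coef beta m) -> alpha = beta.
Proof.
move=> ha hb h; apply/eqP; rewrite -subr_eq0; apply/eqP.
apply: alternating_eq0; first exact: alternatingB.
by move=> m /h; rewrite /coef /ev !fctE => ->; rewrite subrr.
Qed.
End Frame.

Section Differential.
Variables (R : realType) (n : nat).
Implicit Types (l : seq 'rV[R]_n).

Definition delete T (i : nat) (l : seq T) := take i l ++ drop i.+1 l.

Lemma row'_rows_delete k (j : 'I_k.+1) l : size l = k.+1 ->
  row' j (rows k.+1 l) = rows k (delete j l).
Proof.
move=> sl; apply/matrixP=> i c; rewrite !mxE /delete nth_cat size_take sl ltn_ord.
congr (fun_of_matrix _ _ c); rewrite /lift /= /bump.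
case: (ltnP i j) => ij; first by rewrite nth_take // leqNgt ij.
by rewrite nth_drop add1n addSn subnKC.
Qed.

Lemma CE_diffE k br (alpha : kform R n k.+1) l : size l = k.+2 ->
  ev (CE_diff br alpha) l =
  \sum_(j < k.+2) \sum_(i < k.+1) if (i < j)%N then (-1) ^+ (i + j) *
    ev alpha (br (nth 0 (delete j l) i) (nth 0 l j) :: delete i (delete j l)) else 0.
Proof.
move=> sl; rewrite /ev /CE_diff; apply: eq_bigr => j _; rewrite big_mkcond.
apply: eq_bigr => i _; case: ifP => // ij; rewrite rows_cons row'_rows_delete // row'_rows_delete ?row_rows //.
rewrite /delete size_cat size_take size_drop sl ltn_ord.
by have := ltn_ord j; lia.
Qed.

Variables (br : 'rV[R]_n -> 'rV[R]_n -> 'rV[R]_n) (d1 d2 : kform R n 2) (z1 z2 : 'rV[R]_n).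
Hypothesis brE : forall x y, br x y = - (ev d1 [:: x; y] *: z1 + ev d2 [:: x; y] *: z2).
Hypotheses (h1 : alternating d1) (h2 : alternating d2).

Lemma ev_br k (alpha : kform R n k.+1) x y l : alternating alpha -> size l = k ->
  ev alpha (br x y :: l) =
  - (ev d1 [:: x; y] * ev alpha (z1 :: l) + ev d2 [:: x; y] * ev alpha (z2 :: l)).
Proof.
move=> ha sl; rewrite brE opprD -!scaleNr.
rewrite (ev_lin ha (l1 := [::])) //= ?sl //; ring.
Qed.

(** A derivation d is the sum of d z^i /\ i_(z_i), and two covectors at most have a nonzero
    differential. Concretely, choosing the pair that enters the bracket is choosing a shuffle for
    [d1] or [d2]. *)
Lemma CE_diff3 (alpha : kform R n 3) : alternating alpha ->
  CE_diff br alpha =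
  (wedge d1 (contract z1 alpha) : kform R n 4) + wedge d2 (contract z2 alpha).
Proof.
move=> ha; apply/funext => A; rewrite fctE -[A]rows_row.
have : size [seq row i A | i <- enum 'I_4] = 4 by rewrite size_map size_enum_ord.
case: [seq row i A | i <- enum 'I_4] => [|a [|b [|c [|d [|]]]]] // _.
have W (e : kform R n 2) z : alternating e -> wedge e (contract z alpha) (rows 4 [:: a; b; c; d]) =
    shuffle [:: a; b; c; d] 2 2 (ev e) (ev (contract z alpha)).
  by move=> he; apply: wedge_shuffle => //; exact: alternating_contract.
rewrite !W // -[CE_diff _ _ _]/(ev _ _) CE_diffE //.
rewrite !big_ord_recl !big_ord0 /= /bump /= !ev_br // !ev_contract /=.
rewrite !addn0 !add1n !add0n !addSn !add0n /delete /=.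
move: (ev d1) (ev d2) (ev alpha) => e1 e2 e; ring.
Qed.

Lemma CE_diff4 (alpha : kform R n 4) : alternating alpha ->
  CE_diff br alpha =
  (wedge d1 (contract z1 alpha) : kform R n 5) + wedge d2 (contract z2 alpha).
Proof.
move=> ha; apply/funext => A; rewrite fctE -[A]rows_row.
have : size [seq row i A | i <- enum 'I_5] = 5 by rewrite size_map size_enum_ord.
case: [seq row i A | i <- enum 'I_5] => [|a [|b [|c [|d [|f [|]]]]]] // _.
have W (e : kform R n 2) z : alternating e -> wedge e (contract z alpha) (rows 5 [:: a; b; c; d; f]) =
    shuffle [:: a; b; c; d; f] 2 3 (ev e) (ev (contract z alpha)).
  by move=> he; apply: wedge_shuffle => //; exact: alternating_contract.
rewrite !W // -[CE_diff _ _ _]/(ev _ _) CE_diffE //.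
rewrite !big_ord_recl !big_ord0 /= /bump /= !ev_br // !ev_contract /=.
rewrite !addn0 !add1n !add0n !addSn !add0n /delete /=.
move: (ev d1) (ev d2) (ev alpha) => e1 e2 e; ring.
Qed.

End Differential.

(** * The Hodge operator in an orthonormal frame *)

Lemma alternating_det (R : realType) n : alternating (fun A : 'M[R]_n => \det A).
Proof.
split=> [A B C i b c|A i j ij e]; first exact: determinant_multilinear.
apply: (determinant_alternate ij) => k.
by have := congr1 (fun M : 'rV_n => M 0 k) e; rewrite !mxE.
Qed.

Lemma alternating_vol (R : realType) n (g : 'M[R]_n) o : alternating (vol g o).
Proof. by apply: alternatingZ; exact: alternating_det. Qed.

Lemma alternating_sum (R : realType) n k (I : Type) (r : seq I) (F : I -> kform R n k) :
  (forall i, alternating (F i)) -> alternating (fun A => \sum_(i <- r) F i A).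
Proof.
move=> h; elim: r => [|i r IH].
  rewrite (_ : (fun _ => _) = 0); last by apply/funext=> A; rewrite big_nil.
  exact: alternating0.
rewrite (_ : (fun _ => _) = F i + (fun A => \sum_(i <- r) F i A)).
  exact: alternatingD.
by apply/funext=> A; rewrite big_cons.
Qed.

Lemma big_ffun3 (R : realType) (T : finType) (F : T -> T -> T -> R) :
  \sum_(i : {ffun 'I_3 -> T}) F (i ord0) (i (inord 1)) (i ord_max) =
  \sum_a \sum_b \sum_c F a b c.
Proof.
rewrite pair_bigA pair_bigA /=.
pose h (t : T * T * T) : {ffun 'I_3 -> T} :=
  [ffun i : 'I_3 => if val i is 0 then t.1.1 else if val i is 1 then t.1.2 else t.2].
have hb : bijective h.
  exists (fun f : {ffun 'I_3 -> T} => (f ord0, f (inord 1), f ord_max)) => [[[a b] c]|f].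
    by rewrite /h !ffunE /= inordK.
  apply/ffunP=> i; rewrite ffunE; case: i => [[|[|[|]]] //= i3]; congr (f _); apply: val_inj => //=.
  by rewrite inordK.
rewrite (reindex h) /=; last exact: onW_bij.
by apply: eq_bigr => [[[a b] c]] _; rewrite /h !ffunE /= inordK.
Qed.

Lemma row_col_mx_rows (R : realType) n p k (M : 'M[R]_(p, n)) (l : seq 'rV[R]_n) :
  col_mx M (rows k l) = rows (p + k) ([seq row i M | i <- enum 'I_p] ++ l).
Proof.
apply/row_matrixP=> i; rewrite row_rows nth_cat size_map size_enum_ord.
have [j ->|j ->] := split_ordP i; rewrite ?rowKu ?rowKd /=.
  by rewrite (nth_map j) ?size_enum_ord // nth_ord_enum.
by rewrite addKn row_rows.
Qed.

Lemma enum3 : enum 'I_3 = [:: ord0; inord 1; ord_max].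
Proof.
apply: (inj_map val_inj); rewrite val_enum_ord /= inordK //.
Qed.

Section HodgeFrame.
Variables (R : realType) (q : nat).
Variables (g : 'M[R]_(3 + q)) (o : bool) (P : 'M[R]_(3 + q)).
Hypothesis Pg : P *m g *m P^T = 1%:M.

Lemma frame_unit : P \in unitmx.
Proof. by move: Pg; rewrite -mulmxA => /mulmx1_unit []. Qed.

(** The inverse metric is the sum of the tensor squares of the orthonormal frame vectors, the rows
    of [P]. *)
Lemma frame_invmx : invmx g = P^T *m P.
Proof.
have uP := frame_unit; have gE : g = invmx P *m invmx P^T.
  by rewrite -[LHS](mulKmx uP) -[X in _ *m X](mulmxK (_ : P^T \in unitmx)) ?unitmx_tr // Pg mul1mx.
have uT : P^T \in unitmx by rewrite unitmx_tr.
have gg : (P^T *m P) *m g = 1%:M.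
  by rewrite gE !mulmxA -(mulmxA P^T) mulmxV // mulmx1 mulmxV.
have [_ ug] := mulmx1_unit gg.
by rewrite -[RHS](mulmxK ug) gg mul1mx.
Qed.

(* The contraction of two slots by the inverse metric does not depend on the basis. *)
Lemma frame_contraction (F G : 'rV[R]_(3 + q) -> R) :
  (forall (b : 'I_(3 + q) -> R) y, F (\sum_i b i *: y i) = \sum_i b i * F (y i)) ->
  (forall (b : 'I_(3 + q) -> R) y, G (\sum_i b i *: y i) = \sum_i b i * G (y i)) ->
  \sum_a F (row a (invmx g)) * G (row a 1%:M) = \sum_a F (row a P) * G (row a P).
Proof.
move=> hF hG; rewrite frame_invmx.
have e1 a : row a (P^T *m P) = \sum_c P c a *: row c P.
  apply/rowP=> j; rewrite !mxE summxE; apply: eq_bigr => c _; by rewrite !mxE.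
have e2 c : row c P = \sum_a P c a *: row a 1%:M.
  apply/rowP=> j; rewrite !mxE summxE (bigD1 j) //= big1 ?addr0 => [|i ij]; rewrite !mxE.
    by rewrite eqxx mulr1.
  by rewrite (negbTE ij) mulr0.
rewrite (eq_bigr (fun a => \sum_c P c a * F (row c P) * G (row a 1%:M))); last first.
  by move=> a _; rewrite e1 hF mulr_suml.
rewrite exchange_big /=; apply: eq_bigr => c _.
rewrite [in X in _ = _ * X]e2 hG mulr_sumr; apply: eq_bigr => a _; ring.
Qed.

Variable (beta : kform R (3 + q) 3).
Hypothesis hb : alternating beta.

Lemma alternating_hodge : alternating (hodge g o beta).
Proof.
apply: alternatingZ; apply: alternating_sum => i; apply: alternatingZ.
(* Each summand is a multiple of a threefold contraction of the volume form. *)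
have -> : (fun W : 'M_(q, 3 + q) => vol g o (col_mx (rowsub i 1%:M) W)) =
  contract (row ord_max (rowsub i 1%:M)) (contract (row (inord 1) (rowsub i 1%:M))
    (contract (row ord0 (rowsub i 1%:M)) (vol g o : kform R (3 + q) q.+3))).
  apply/funext => W; rewrite -[W]rows_row row_col_mx_rows enum3 /=.
  by rewrite -[RHS]/(ev (contract _ (contract _ (contract _ _))) _) !ev_contract.
do 3!apply: alternating_contract; exact: alternating_vol.
Qed.

(** The definition pairs a reciprocal basis with the standard one; [frame_contraction] turns both
    into the orthonormal frame, one slot at a time, starting with the third. *)
Lemma hodge_frame l : size l = q ->
  ev (hodge g o beta) l = 6%:R^-1 *
  \sum_a \sum_b \sum_c ev beta [:: row a P; row b P; row c P] *
    ev (vol g o) [:: row a P, row b P, row c P & l].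
Proof.
move=> sl; pose G a := row a (invmx g); pose e a := row a (1%:M : 'M[R]_(3 + q)).
have -> : ev (hodge g o beta) l = 6%:R^-1 *
  \sum_a \sum_b \sum_c ev beta [:: G a; G b; G c] *
    ev (vol g o) [:: e a, e b, e c & l].
  rewrite /ev /hodge; congr (_ * _).
  rewrite -(big_ffun3 (fun a b c => ev beta [:: G a; G b; G c] *
    ev (vol g o) [:: e a, e b, e c & l])).
  apply: eq_bigr => i _; congr (_ * _).
    rewrite /ev -[rowsub _ _]rows_row enum3 /=; congr (beta (rows _ _)).
    by rewrite /G !row_rowsub.
  rewrite row_col_mx_rows enum3 /= /ev /e.
  by rewrite !row_rowsub.
congr (_ * _).
have hbl l1 l2 : (size l1 + size l2)%N = 2 -> forall (b : 'I_(3 + q) -> R) y,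
    ev beta (l1 ++ (\sum_i b i *: y i) :: l2) = \sum_i b i * ev beta (l1 ++ y i :: l2).
  by move=> s b y; rewrite ev_sum // s.
have hvl l1 l2 : (size l1 + size l2)%N = q.+2 -> forall (b : 'I_(3 + q) -> R) y,
    ev (vol g o) (l1 ++ (\sum_i b i *: y i) :: l2) = \sum_i b i * ev (vol g o) (l1 ++ y i :: l2).
  by move=> s b y; rewrite ev_sum ?s //; exact: alternating_vol.
transitivity (\sum_a \sum_b \sum_c ev beta [:: G a; G b; row c P] *
    ev (vol g o) [:: e a, e b, row c P & l]).
  apply: eq_bigr => a _; apply: eq_bigr => b _.
  apply: (@frame_contraction (fun v => ev beta [:: G a; G b; v])
    (fun v => ev (vol g o) [:: e a, e b, v & l])).
    exact: (hbl [:: _; _] [::]).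
  by apply: (hvl [:: _; _]); rewrite sl.
transitivity (\sum_a \sum_b \sum_c ev beta [:: G a; row b P; row c P] *
    ev (vol g o) [:: e a, row b P, row c P & l]).
  apply: eq_bigr => a _; rewrite exchange_big [RHS]exchange_big; apply: eq_bigr => c _.
  apply: (@frame_contraction (fun v => ev beta [:: G a; v; row c P])
    (fun v => ev (vol g o) [:: e a, v, row c P & l])).
    exact: (hbl [:: _] [:: _]).
  by apply: (hvl [:: _]); rewrite /= sl.
rewrite exchange_big [RHS]exchange_big; apply: eq_bigr => b _.
rewrite exchange_big [RHS]exchange_big; apply: eq_bigr => c _.
apply: (@frame_contraction (fun v => ev beta [:: v; row b P; row c P])
    (fun v => ev (vol g o) [:: v, row b P, row c P & l])).
  exact: (hbl [::] [:: _; _]).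
by apply: (hvl [::]); rewrite /= sl.
Qed.
End HodgeFrame.

Definition compl7 (m : seq nat) : seq nat :=
  [seq i <- iota 0 7 | negb (has (Nat.eqb i) m)].

(* Up to the factor [frame_vol], the coefficients of the Hodge dual of a 3-form with
   coefficients [c]. *)
Definition star (R : realType) (c : seq nat -> R) (m : seq nat) : R :=
  if alt_sort (compl7 m ++ m) is Some (b, _) then signed b (c (compl7 m)) else 0.

Definition triples : seq (seq nat) :=
  flatten [seq flatten [seq [seq [:: a; b; c] | c <- iota 0 7] | b <- iota 0 7] | a <- iota 0 7].

Lemma sum_triples (R : realType) (F : seq nat -> R) :
  \sum_(a < 7) \sum_(b < 7) \sum_(c < 7) F [:: val a; val b; val c] = \sum_(t <- triples) F t.
Proof.
have sE (f : nat -> R) : \sum_(a < 7) f a = \sum_(a <- iota 0 7) f a.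
  by rewrite -(big_mkord xpredT f).
rewrite /triples big_flatten big_map.
rewrite (sE (fun a => \sum_(b < 7) \sum_(c < 7) F [:: a; val b; val c])).
apply: eq_bigr => a _; rewrite big_flatten big_map.
rewrite (sE (fun b => \sum_(c < 7) F [:: a; b; val c])).
by apply: eq_bigr => b _; rewrite big_map (sE (fun c => F [:: a; b; c])).
Qed.

(** Of the 343 triples only the six orderings of the complement of [m] count. They contribute
    equally, the signs of [c] and [v] cancelling, and the resulting 6 cancels the 1/3! of the Hodge
    operator. *)
Lemma sum_antisym3 (R : realType) (c v : seq nat -> R) (m : seq nat) :
  antisym 3 c -> antisym 7 v -> m \in combs (iota 0 7) 4 ->
  \sum_(t <- triples) c t * v (t ++ m) = 6%:R * (v (iota 0 7) * star c m).
Proof.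
move=> hc hv hm.
have sm : size m = 4.
  by apply/eqP; move: m hm; apply/allP; vm_compute.
rewrite (eq_big_seq (fun t => sorted_coef c t * sorted_coef v (t ++ m))); last first.
  move=> t ht; have st : size t = 3 by apply/eqP; move: t ht; apply/allP; vm_compute.
  by rewrite -(sorted_coefE hc) // -(sorted_coefE hv) // size_cat st sm.
(* A triple that is not an ordering of the complement makes [t ++ m] repeat an index. *)
rewrite (bigID (fun t => isSome (alt_sort (t ++ m)))) /= addrC big1 ?add0r; last first.
  by move=> t; rewrite /sorted_coef; case: alt_sort => // _; rewrite mulr0.
rewrite -big_filter.
let M := eval vm_compute in (combs (iota 0 7) 4) in change (is_true (m \in M)) in hm.
(* [go] keeps the filtered list folded until [m] is one of 35 concrete lists and the six triples can
   be computed. *)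
have go L : filter (fun t => isSome (alt_sort (t ++ m))) triples = L ->
    \sum_(t <- L) sorted_coef c t * sorted_coef v (t ++ m) = 6%:R * (v (iota 0 7) * star c m) ->
    \sum_(t <- filter (fun t => isSome (alt_sort (t ++ m))) triples)
      sorted_coef c t * sorted_coef v (t ++ m) = 6%:R * (v (iota 0 7) * star c m) by move=> ->.
move: m {sm} hm go.
do 35 (move=> m /predU1P[-> go|]; [apply: go; [vm_compute; reflexivity|];
  rewrite !big_cons big_nil;
  cbv [sorted_coef star compl7 alt_sort insert Nat.ltb Nat.leb Nat.eqb xorb negb signed cat filter has iota orb];
  ring |move: m]).
by [].
Qed.

Section Frame7.
Variables (R : realType) (g : 'M[R]_7) (o : bool) (P : 'M[R]_7).
Hypotheses (Pg : P *m g *m P^T = 1%:M) (gI : inner_product g).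

Definition frame (i : nat) : 'rV[R]_7 := row (inord i) P.

Lemma frameE (i : 'I_7) : frame i = row i P.
Proof. by rewrite /frame inord_val. Qed.

Lemma frame_rows : rows 7 (map frame (iota 0 7)) = P.
Proof.
by apply/row_matrixP=> i; rewrite row_rows (nth_map 0%N) ?size_iota // nth_iota // frameE.
Qed.

Lemma frame_span v : exists b : 'I_7 -> R, v = \sum_(i < 7) b i *: frame i.
Proof.
exists (fun i => (v *m invmx P) 0 i).
rewrite -[LHS](mulmxKV (@frame_unit R 4 _ _ Pg)) mulmx_sum_row.
by apply: eq_bigr => i _; rewrite frameE.
Qed.

(** This is 1 or -1, according to whether the frame agrees with the orientation [o]. *)
Definition frame_vol : R := coef frame (vol g o) (iota 0 7).

Lemma frame_vol_sqr : frame_vol ^+ 2 = 1.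
Proof.
rewrite /frame_vol /coef /ev frame_rows /vol !exprMn sqrr_sign mul1r.
rewrite sqr_sqrtr; last exact/ltW/inner_product_det_gt0.
by rewrite -(det1 R 7) -Pg !det_mulmx det_tr; ring.
Qed.

Lemma ip_frame i j : (i < 7)%N -> (j < 7)%N -> ip g (frame i) (frame j) = (i == j)%:R.
Proof.
move=> i7 j7; rewrite /ip /frame -row_mul tr_row -row_mul colE mulmxA -colE Pg !mxE.
by rewrite -val_eqE /= !inordK.
Qed.

Variable phi : kform R 7 3.
Hypothesis hphi : alternating phi.

Lemma coef_hodge m : m \in combs (iota 0 7) 4 ->
  coef frame (@hodge R 3 4 g o phi) m = frame_vol * star (coef frame phi) m.
Proof.
move=> hm; have sm : size m = 4 by apply/eqP; move: m hm; apply/allP; vm_compute.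
rewrite /coef (hodge_frame (q := 4) o Pg hphi) ?size_map //.
have f6 : 6%:R != 0 :> R by rewrite pnatr_eq0.
apply: (mulfI f6); rewrite mulVKf //.
rewrite -sum_antisym3 //; try exact: coef_antisym.
  rewrite -sum_triples; apply: eq_bigr => a _; apply: eq_bigr => b _; apply: eq_bigr => c _.
  by rewrite /coef /= !frameE.
by apply: coef_antisym; exact: alternating_vol.
Qed.

End Frame7.

(** * Compatibility and pure coclosedness in components *)

Section Coordinates.
Variable R : realType.
Implicit Types (a b c : seq nat -> R).

(** The form B of the overview on the frame; [a] and [b] stand for the contractions of phi by its
    two arguments. *)
Definition form_B a b c : R :=
  shuffle (iota 0 7) 4 3 (fun m => shuffle m 2 2 a b) (sorted_coef c).

(* As [h_3^C + R] is 2-step nilpotent with derived algebra [<x_4, x_5>], the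
   differential of a form is the sum of [d_a /\ i_(x_a)] over [a = 4, 5]. *)
Definition form_d (d1 d2 : seq nat -> R) c (q : nat) (m : seq nat) : R :=
  shuffle m 2 q (sorted_coef d1) (fun t => sorted_coef c (4%N :: t)) +
  shuffle m 2 q (sorted_coef d2) (fun t => sorted_coef c (5%N :: t)).

Variables (g : 'M[R]_7) (o : bool) (P : 'M[R]_7).
Hypotheses (Pg : P *m g *m P^T = 1%:M) (gI : inner_product g).
Notation x := (frame P).
Notation eps := (frame_vol g o P).

Variables (phi : kform R 7 3) (c : seq nat -> R).
Hypotheses (hphi : alternating phi) (hc : forall m, m \in combs (iota 0 7) 3 -> coef x phi m = c m).
Let lt7 (m : seq nat) := all (fun i => i < 7)%N m.

Lemma coef_phi m : size m = 3 -> lt7 m -> coef x phi m = sorted_coef c m.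
Proof. by apply: (sorted_coef_ext _ hc); exact: coef_antisym. Qed.

Lemma coef_BB (a b : seq nat -> R) (v w : 'rV[R]_7) :
  (forall m, size m = 2 -> lt7 m -> ev phi (v :: map x m) = a m) ->
  (forall m, size m = 2 -> lt7 m -> ev phi (w :: map x m) = b m) ->
  coef x (wedge (wedge (contract v phi) (contract w phi)) phi) (iota 0 7) = form_B a b c.
Proof.
move=> ha hb.
rewrite coef_wedge //; last by apply: alternating_wedge; exact: alternating_contract.
apply: (@eq_shuffle _ _ (fun i => i < 7)%N) => //; last exact: coef_phi.
move=> m sm lm; rewrite coef_wedge //; try exact: alternating_contract.
by apply: (@eq_shuffle _ _ (fun i => i < 7)%N) => // t st lt; rewrite /coef ev_contract ?ha ?hb.
Qed.

Lemma compatible_frame : G2_compatible phi (g, o) ->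
  forall i j, (i < 7)%N -> (j < 7)%N ->
  form_B (fun m => sorted_coef c (i :: m)) (fun m => sorted_coef c (j :: m)) c =
    6%:R * ((i == j)%:R * eps).
Proof.
move=> [_ /= h] i j i7 j7.
rewrite -(@coef_BB _ _ (x i) (x j)).
- have := h (x i) (x j) (rows 7 (map x (iota 0 7))); rewrite ip_frame //.
  rewrite -/(ev _ _) -/(frame_vol g o P) => ->.
  by rewrite mulrA divff ?mul1r // pnatr_eq0.
- by move=> m sm lm; rewrite -coef_phi //= ?sm ?i7.
- by move=> m sm lm; rewrite -coef_phi //= ?sm ?j7.
Qed.

Lemma frame_compatible :
  (forall v w : nat -> R,
    form_B (fun m => \sum_(i < 7) v i * sorted_coef c (val i :: m))
           (fun m => \sum_(i < 7) w i * sorted_coef c (val i :: m)) c =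
    6%:R * ((\sum_(i < 7) v i * w i) * eps)) ->
  G2_compatible phi (g, o).
Proof.
move=> h; split=> //= v w A.
have [bv vE] := frame_span Pg v; have [bw ew] := frame_span Pg w.
pose v' i := bv (inord i); pose w' i := bw (inord i).
have hv m : size m = 2 -> lt7 m -> ev phi (v :: map x m) =
    \sum_(i < 7) v' i * sorted_coef c (val i :: m).
  move=> sm lm; rewrite vE (ev_sum hphi (l1 := [::])) ?size_map ?sm //.
  by apply: eq_bigr => i _; rewrite /v' inord_val -coef_phi //= ?sm ?ltn_ord.
have hw m : size m = 2 -> lt7 m -> ev phi (w :: map x m) =
    \sum_(i < 7) w' i * sorted_coef c (val i :: m).
  move=> sm lm; rewrite ew (ev_sum hphi (l1 := [::])) ?size_map ?sm //.
  by apply: eq_bigr => i _; rewrite /w' inord_val -coef_phi //= ?sm ?ltn_ord.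
have ipE : ip g v w = \sum_(i < 7) v' i * w' i.
  rewrite vE ew /ip mulmx_suml mulmx_suml summxE; apply: eq_bigr => i _.
  rewrite linear_sum /= mulmx_sumr summxE (bigD1 i) //= big1 ?addr0 => [|j ji].
    rewrite linearZ /= -scalemxAr -!scalemxAl scalerA [LHS]mxE -/(ip g (x i) (x i)) ip_frame //.
    by rewrite eqxx mulr1 /v' /w' inord_val mulrC.
  rewrite linearZ /= -scalemxAr -!scalemxAl scalerA [LHS]mxE -/(ip g (x i) (x j)) ip_frame //.
  by rewrite eq_sym val_eqE (negbTE ji) mulr0.
suff E : (fun B => ip g v w * vol g o B) =
    (fun B => 6%:R^-1 * wedge (wedge (contract v phi) (contract w phi)) phi B).
  by have := congr1 (fun f => f A) E.
apply: (alternating_ext (frame_span Pg)).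
- by apply: alternatingZ; exact: alternating_vol.
- apply: alternatingZ; apply: (@alternating_wedge _ _ 4 3) => //.
  by apply: (@alternating_wedge _ _ 2 2); exact: alternating_contract.
(* A 7-form on R^7 has a single coefficient. *)
move=> m; rewrite (_ : combs _ _ = [:: iota 0 7]) // inE => /eqP ->.
rewrite -[LHS]/(ip g v w * eps).
rewrite -[RHS]/(6%:R^-1 * coef x (wedge (wedge (contract v phi) (contract w phi)) phi) (iota 0 7)).
by rewrite (coef_BB hv hw) h ipE mulKf // pnatr_eq0.
Qed.

(** Nondegeneracy is positivity of [g]: the 7-form in question is 6 g(v, v) vol, and vol does not
    vanish on the frame. *)
Lemma compatible_G2 : G2_compatible phi (g, o) -> G2_structure phi.
Proof.
move=> [_ /= h]; split=> // v v0 w0.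
have : ip g v v * vol g o P = 0 by rewrite h w0; exact: mulr0.
move/eqP; rewrite mulf_eq0 gt_eqF /=; last exact: gI.2.
have := frame_vol_sqr o Pg gI; rewrite /frame_vol /coef /ev frame_rows.
by move=> e /eqP e0; move/eqP: e; rewrite e0 expr0n /= eq_sym oner_eq0.
Qed.

Variables (br : 'rV[R]_7 -> 'rV[R]_7 -> 'rV[R]_7) (d1 d2 : kform R 7 2) (e1 e2 : seq nat -> R).
Hypothesis brE : forall u v, br u v = - (ev d1 [:: u; v] *: x 4 + ev d2 [:: u; v] *: x 5).
Hypotheses (h1 : alternating d1) (h2 : alternating d2).
Hypothesis he1 : forall m, m \in combs (iota 0 7) 2 -> coef x d1 m = e1 m.
Hypothesis he2 : forall m, m \in combs (iota 0 7) 2 -> coef x d2 m = e2 m.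

Lemma coef_d1 m : size m = 2 -> lt7 m -> coef x d1 m = sorted_coef e1 m.
Proof. by apply: (sorted_coef_ext _ he1); exact: coef_antisym. Qed.

Lemma coef_d2 m : size m = 2 -> lt7 m -> coef x d2 m = sorted_coef e2 m.
Proof. by apply: (sorted_coef_ext _ he2); exact: coef_antisym. Qed.

Lemma coef_psi m : size m = 4 -> lt7 m ->
  coef x (@hodge R 3 4 g o phi) m = eps * sorted_coef (star c) m.
Proof.
move=> sm lm; rewrite (@sorted_coef_ext _ 7 4 _ (fun m => eps * star c m)) //.
- by rewrite /sorted_coef; case: alt_sort => [[b l]|]; rewrite ?mulr0 // signedZ.
- by apply: coef_antisym; apply: alternating_hodge.
move=> {m sm lm} m hm; rewrite coef_hodge //; congr (_ * _).
rewrite /star; case: alt_sort => [[b l]|//]; congr signed; apply: hc.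
by move: m hm; apply/allP; vm_compute.
Qed.

Lemma coef_dpsi m : m \in combs (iota 0 7) 5 ->
  coef x (CE_diff br (@hodge R 3 4 g o phi)) m = eps * form_d e1 e2 (star c) 3 m.
Proof.
move=> hm; have /andP[/eqP sm lm] : (size m == 5) && lt7 m by move: m hm; apply/allP; vm_compute.
have hpsi : alternating (@hodge R 3 4 g o phi) by apply: alternating_hodge.
rewrite (CE_diff4 brE h1 h2 hpsi).
have W i (d : kform R 7 2) e : (i < 7)%N -> alternating d ->
    (forall m, size m = 2 -> lt7 m -> coef x d m = sorted_coef e m) ->
    coef x (wedge d (contract (x i) (@hodge R 3 4 g o phi)) : kform R 7 5) m =
    eps * shuffle m 2 3 (sorted_coef e) (fun t => sorted_coef (star c) (i :: t)).
  move=> i7 hd hde; rewrite -shuffleZr.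
  rewrite [LHS](@coef_wedge _ _ _ 2 3) //; last exact: alternating_contract.
  apply: (@eq_shuffle _ _ (fun i => i < 7)%N) => // t st lt.
  by rewrite coef_contract coef_psi //= ?st ?i7.
rewrite /form_d mulrDr -(W 4%N d1) // -?(W 5%N d2) //.
  exact: coef_d2.
exact: coef_d1.
Qed.

Lemma coef_dphi_phi :
  coef x (wedge (CE_diff br phi) phi) (iota 0 7) =
  shuffle (iota 0 7) 4 3 (form_d e1 e2 c 2) (sorted_coef c).
Proof.
have aW i (d : kform R 7 2) : alternating d ->
  alternating (wedge d (contract (x i) phi) : kform R 7 4).
  by move=> hd; apply: (@alternating_wedge _ _ 2 2) => //; exact: alternating_contract.
rewrite (CE_diff3 brE h1 h2 hphi) coef_wedge //; last first.
  by apply: alternatingD; apply: aW.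
apply: (@eq_shuffle _ _ (fun i => i < 7)%N) => //; last exact: coef_phi.
move=> m sm lm.
have W i (d : kform R 7 2) e : (i < 7)%N -> alternating d ->
    (forall m, size m = 2 -> lt7 m -> coef x d m = sorted_coef e m) ->
    coef x (wedge d (contract (x i) phi) : kform R 7 4) m =
    shuffle m 2 2 (sorted_coef e) (fun t => sorted_coef c (i :: t)).
  move=> i7 hd hde.
  rewrite [LHS](@coef_wedge _ _ _ 2 2) //; last exact: alternating_contract.
  apply: (@eq_shuffle _ _ (fun i => i < 7)%N) => // t st lt.
  by rewrite coef_contract coef_phi //= ?st ?i7.
rewrite /form_d -(W 4%N d1) // -?(W 5%N d2) //.
  exact: coef_d2.
exact: coef_d1.
Qed.

Lemma coclosed_frame : CE_diff br (@hodge R 3 4 g o phi) = 0 <->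
  forall m, m \in combs (iota 0 7) 5 -> form_d e1 e2 (star c) 3 m = 0.
Proof.
have e0 : eps != 0.
  by rewrite -sqrf_eq0 (frame_vol_sqr o Pg gI) oner_eq0.
split=> [h m hm|h].
  by apply: (mulfI e0); rewrite -coef_dpsi // h mulr0.
apply: (alternating_eq0 (frame_span Pg)).
  have hpsi : alternating (@hodge R 3 4 g o phi) by apply: alternating_hodge.
  rewrite (CE_diff4 brE h1 h2 hpsi); apply: alternatingD;
  by apply: (@alternating_wedge _ _ 2 3) => //; exact: alternating_contract.
by move=> m hm; rewrite coef_dpsi // h // mulr0.
Qed.

Lemma pure_frame : wedge (CE_diff br phi) phi = 0 <->
  shuffle (iota 0 7) 4 3 (form_d e1 e2 c 2) (sorted_coef c) = 0.
Proof.
rewrite -coef_dphi_phi; split=> [-> //|h].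
apply: (alternating_eq0 (frame_span Pg)).
  apply: (@alternating_wedge _ _ 4 3) => //.
  rewrite (CE_diff3 brE h1 h2 hphi); apply: alternatingD;
  by apply: (@alternating_wedge _ _ 2 2) => //; exact: alternating_contract.
by move=> m; rewrite (_ : combs _ _ = [:: iota 0 7]) // inE => /eqP ->.
Qed.

End Coordinates.

(** * Algebra of the component equations *)

Definition next3 (i : nat) : nat := match i with 0 => 1 | 1 => 2 | _ => 0 end%N.

Ltac expand := cbv [form_B form_d shuffle sorted_coef star compl7 alt_sort insert Nat.ltb Nat.leb Nat.eqb
  xorb negb signed cat filter has iota orb odd comp next3].

Section Algebra.
Variable R : realType.
Implicit Types (c : seq nat -> R) (X p m : nat -> nat -> R) (t : R).

(** With indices shifted by one, these are the monomials f^13, f^24, f^14, f^23 that occur in d f^5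
    and d f^6. *)
Definition two_form (a02 a13 a03 a12 : R) (l : seq nat) : R :=
  match l with
  | [:: 0; 2]%N => a02 | [:: 1; 3]%N => a13 | [:: 0; 3]%N => a03 | [:: 1; 2]%N => a12
  | _ => 0
  end.

(* Row [z] of [p] (of [m]) holds the coordinates of the self-dual (anti-self-dual)
   part of [omega_z] in the basis 01 + 23, 02 - 13, 03 + 12 (01 - 23, 02 + 13,
   03 - 12); the signs of [X] are those of [z^jk] for cyclic [ijk]. *)
Definition three_form t X p m (l : seq nat) : R :=
  match l with
  | [:: 4; 5; 6]%N => t
  | [:: 0; 1; z.+4]%N => p z 0%N + m z 0%N
  | [:: 2; 3; z.+4]%N => p z 0%N - m z 0%N
  | [:: 0; 2; z.+4]%N => p z 1%N + m z 1%N
  | [:: 1; 3; z.+4]%N => m z 1%N - p z 1%N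
  | [:: 0; 3; z.+4]%N => p z 2%N + m z 2%N
  | [:: 1; 2; z.+4]%N => p z 2%N - m z 2%N
  | [:: v; 5; 6]%N => X 0%N v
  | [:: v; 4; 6]%N => - X 1%N v
  | [:: v; 4; 5]%N => X 2%N v
  | _ => 0
  end.

(** Taking the two other rows and columns in cyclic order absorbs the sign (-1)^(i+j) of the
    cofactor. *)
Definition cof3 p (i j : nat) : R :=
  p (next3 i) (next3 j) * p (next3 (next3 i)) (next3 (next3 j)) -
  p (next3 i) (next3 (next3 j)) * p (next3 (next3 i)) (next3 j).

Definition det3 p : R := p 0%N 0%N * cof3 p 0 0 + p 1%N 0%N * cof3 p 1 0 + p 2%N 0%N * cof3 p 2 0.

(* The entries of [\adj P *m M + P^T *m (\adj M)^T]. *)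
Definition mixed p m (a b : nat) : R :=
  (cof3 p 0 a * m 0%N b + cof3 p 1 a * m 1%N b + cof3 p 2 a * m 2%N b) +
  (p 0%N a * cof3 m 0 b + p 1%N a * cof3 m 1 b + p 2%N a * cof3 m 2 b).

Definition B3 c i j := form_B (fun l => sorted_coef c (i :: l)) (fun l => sorted_coef c (j :: l)) c.

Section VV.
Variables (t : R) (X p m : nat -> nat -> R).
Notation c := (three_form t X p m).
Notation T := (mixed p m).
Notation D := (det3 p + det3 m).

Ltac B3_ring := rewrite /B3; expand; cbv [three_form mixed det3 cof3 next3]; ring.

(** The ten values of B on V have trace -24 [D]; their trace-free part, in S^2_0 V = Lambda^+ tensor
    Lambda^-, has the nine entries of [T] as coordinates. *)
Lemma B3_00 : B3 c 0 0 = - 6%:R * (T 0%N 0%N + T 1%N 1%N + T 2%N 2%N + D).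
Proof. B3_ring. Qed.
Lemma B3_11 : B3 c 1 1 = - 6%:R * (T 0%N 0%N - T 1%N 1%N - T 2%N 2%N + D).
Proof. B3_ring. Qed.
Lemma B3_22 : B3 c 2 2 = - 6%:R * (- T 0%N 0%N + T 1%N 1%N - T 2%N 2%N + D).
Proof. B3_ring. Qed.
Lemma B3_33 : B3 c 3 3 = - 6%:R * (- T 0%N 0%N - T 1%N 1%N + T 2%N 2%N + D).
Proof. B3_ring. Qed.
Lemma B3_01 : B3 c 0 1 = 6%:R * (T 1%N 2%N - T 2%N 1%N).
Proof. B3_ring. Qed.
Lemma B3_02 : B3 c 0 2 = - 6%:R * (T 0%N 2%N - T 2%N 0%N).
Proof. B3_ring. Qed.
Lemma B3_03 : B3 c 0 3 = 6%:R * (T 0%N 1%N - T 1%N 0%N).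
Proof. B3_ring. Qed.
Lemma B3_12 : B3 c 1 2 = - 6%:R * (T 0%N 1%N + T 1%N 0%N).
Proof. B3_ring. Qed.
Lemma B3_13 : B3 c 1 3 = - 6%:R * (T 0%N 2%N + T 2%N 0%N).
Proof. B3_ring. Qed.
Lemma B3_23 : B3 c 2 3 = - 6%:R * (T 1%N 2%N + T 2%N 1%N).
Proof. B3_ring. Qed.
End VV.

Lemma mixed_eq0 t X p m (e : R) :
  (forall i j, (i < 7)%N -> (j < 7)%N ->
     B3 (three_form t X p m) i j = 6%:R * ((i == j)%:R * e)) ->
  (forall a b, (a < 3)%N -> (b < 3)%N -> mixed p m a b = 0) /\ det3 p + det3 m = - e.
Proof.
move=> h.
have := h 0%N 0%N isT isT; have := h 1%N 1%N isT isT; have := h 2%N 2%N isT isT; have := h 3%N 3%N isT isT.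
have := h 0%N 1%N isT isT; have := h 0%N 2%N isT isT; have := h 0%N 3%N isT isT; have := h 1%N 2%N isT isT.
have := h 1%N 3%N isT isT; have := h 2%N 3%N isT isT => {h}.
rewrite B3_00 B3_11 B3_22 B3_33 B3_01 B3_02 B3_03 B3_12 B3_13 B3_23 /= !mul0r !mul1r.
move=> h1 h2 h3 h4 h5 h6 h7 h8 h9 h10; split; last lra.
by move=> [|[|[|]]] // [|[|[|]]] // _ _; lra.
Qed.

Lemma det_mx22 (A : 'M[R]_2) : \det A = A 0 0 * A 1 1 - A 0 1 * A 1 0.
Proof.
have l01 : lift ord0 ord0 = 1 :> 'I_2 by exact: val_inj.
rewrite (expand_det_row _ 0) big_ord_recl big_ord1 /cofactor l01 !det_mx11 !mxE /=.
have -> : lift ord0 0 = 1 :> 'I_2 by exact: val_inj.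
have -> : lift 1 0 = 0 :> 'I_2 by exact: val_inj.
by rewrite !mul1r mulN1r mulrN.
Qed.

Definition mx3 p : 'M[R]_3 := \matrix_(i, j) p (val i) (val j).

Lemma cofactor_mx3 p (i j : 'I_3) : cofactor (mx3 p) i j = cof3 p (val i) (val j).
Proof.
rewrite /cofactor det_mx22 !mxE /=.
by case: i => [[|[|[|]]]] //= ?; case: j => [[|[|[|]]]] //= ?;
  rewrite /cof3 /= /bump /=; ring.
Qed.

Lemma det_mx3 p : \det (mx3 p) = det3 p.
Proof.
rewrite (expand_det_col _ ord0) !big_ord_recl big_ord0 !cofactor_mx3 !mxE /=.
by rewrite /det3 addr0 addrA.
Qed.

Lemma mx3_eq0 p : mx3 p = 0 -> forall a b, (a < 3)%N -> (b < 3)%N -> p a b = 0.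
Proof.
move=> h a b a3 b3; have := congr1 (fun M : 'M_3 => M (Ordinal a3) (Ordinal b3)) h.
by rewrite !mxE.
Qed.

Lemma adj_mixed_mx p m : (forall a b, (a < 3)%N -> (b < 3)%N -> mixed p m a b = 0) ->
  \adj (mx3 p) *m mx3 m + (mx3 p)^T *m (\adj (mx3 m))^T = 0.
Proof.
move=> h; apply/matrixP=> a b; rewrite !mxE !big_ord_recl !big_ord0 !mxE !cofactor_mx3 /= !addr0.
by rewrite !addrA -(h a b) // /mixed !addrA.
Qed.

Lemma mulmx_tr_eq0 k l (M : 'M[R]_(k, l)) : M *m M^T = 0 -> M = 0.
Proof.
move=> h; apply/matrixP=> i j; have := congr1 (fun N : 'M_k => N i i) h.
rewrite !mxE => /eqP; rewrite psumr_eq0 => [|a _]; last by rewrite mxE -expr2 sqr_ge0.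
by move=> /allP /(_ j); rewrite mem_index_enum mxE -expr2 sqrf_eq0 => /(_ isT) /eqP.
Qed.

Lemma adj_mixed_dichotomy (P M : 'M[R]_3) :
  \adj P *m M + P^T *m (\adj M)^T = 0 -> \det P + \det M != 0 -> P = 0 \/ M = 0.
Proof.
move=> h d0.
(* Multiply by [P] on the left and by [M^T] on the right. *)
have e : \det P *: (M *m M^T) = - (\det M *: (P *m P^T)).
  have := congr1 (fun N => P *m N *m M^T) h.
  rewrite mulmx0 mul0mx mulmxDr mulmxDl !mulmxA mul_mx_adj -mulmxA -(mulmxA (P *m P^T)).
  rewrite -trmx_mul mul_mx_adj tr_scalar_mx !mul_scalar_mx mul_mx_scalar => /eqP.
  by rewrite addr_eq0 => /eqP.
(* Determinants of [e], in dimension 3: det(P)^3 det(M)^2 = - det(M)^3 det(P)^2. *)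
have de : (\det P * \det M) ^+ 2 * (\det P + \det M) = 0.
  have := congr1 determinant e.
  rewrite -scaleNr !detZ !det_mulmx !det_tr => e3.
  have -> : (\det P * \det M) ^+ 2 * (\det P + \det M) =
    \det P ^+ 3 * (\det M * \det M) - (- \det M) ^+ 3 * (\det P * \det P) by ring.
  by rewrite e3 subrr.
move/eqP: de; rewrite mulf_eq0 (negbTE d0) orbF sqrf_eq0 mulf_eq0.
(* If det P = 0 then det M is nonzero, so [e] gives P P^T = 0 and hence P = 0 over the reals;
   likewise with M. *)
case/orP => /eqP d; move: e; rewrite d scale0r.
  left; apply: mulmx_tr_eq0; move/esym/eqP: e; rewrite oppr_eq0 scaler_eq0.
  by rewrite d add0r in d0; rewrite (negbTE d0) => /eqP.
right; apply: mulmx_tr_eq0; move/eqP: e; rewrite oppr0 scaler_eq0.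
by rewrite d addr0 in d0; rewrite (negbTE d0) => /eqP.
Qed.

Lemma selfdual_or_antiselfdual t X p m (e : R) : e != 0 ->
  (forall i j, (i < 7)%N -> (j < 7)%N ->
     B3 (three_form t X p m) i j = 6%:R * ((i == j)%:R * e)) ->
  (forall a b, (a < 3)%N -> (b < 3)%N -> p a b = 0) \/
  (forall a b, (a < 3)%N -> (b < 3)%N -> m a b = 0).
Proof.
move=> e0 /mixed_eq0 [/adj_mixed_mx h d].
case: (adj_mixed_dichotomy h); first by rewrite !det_mx3 d oppr_eq0.
- by move=> /mx3_eq0; left.
- by move=> /mx3_eq0; right.
Qed.

Section SelfDual.
Variables (t : R) (X p : nat -> nat -> R).
Notation c := (three_form t X p (fun _ _ => 0)).

Definition pullX (a v : nat) : R := p 0%N a * X 0%N v + p 1%N a * X 1%N v + p 2%N a * X 2%N v.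

(* The matrix [P] factors out of [B(x_i, V)], leaving a constant-coefficient system
   in the contractions of the [xi_i] with the columns of [P]. *)
Definition Bpull (a v : nat) : R :=
  let Y := pullX in
  match a, v with
  | 0%N, 0%N => Y 0%N 0%N - Y 1%N 3%N + Y 2%N 2%N
  | 1%N, 0%N => Y 1%N 0%N + Y 0%N 3%N - Y 2%N 1%N
  | 2%N, 0%N => Y 2%N 0%N - Y 0%N 2%N + Y 1%N 1%N
  | 0%N, 1%N => Y 0%N 1%N - Y 1%N 2%N - Y 2%N 3%N
  | 1%N, 1%N => Y 1%N 1%N + Y 0%N 2%N + Y 2%N 0%N
  | 2%N, 1%N => Y 2%N 1%N + Y 0%N 3%N - Y 1%N 0%N
  | 0%N, 2%N => Y 0%N 2%N + Y 1%N 1%N - Y 2%N 0%N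
  | 1%N, 2%N => Y 1%N 2%N - Y 0%N 1%N - Y 2%N 3%N
  | 2%N, 2%N => Y 2%N 2%N + Y 0%N 0%N + Y 1%N 3%N
  | 0%N, 3%N => Y 0%N 3%N + Y 1%N 0%N + Y 2%N 1%N
  | 1%N, 3%N => Y 1%N 3%N - Y 0%N 0%N + Y 2%N 2%N
  | 2%N, 3%N => Y 2%N 3%N - Y 0%N 1%N - Y 1%N 2%N
  | _, _ => 0
  end.

Lemma B3_mixed i v : (i < 3)%N -> (v < 4)%N ->
  B3 c i.+4 v = 3%:R * (p i 0%N * Bpull 0 v + p i 1%N * Bpull 1 v + p i 2%N * Bpull 2 v).
Proof.
by case: i => [|[|[|]]] //; case: v => [|[|[|[|]]]] // _ _;
  rewrite /B3; expand; cbv [three_form Bpull pullX]; ring.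
Qed.

Lemma mx3_ker (q : nat -> nat -> R) (f : nat -> R) : det3 q != 0 ->
  (forall i, (i < 3)%N -> q i 0%N * f 0%N + q i 1%N * f 1%N + q i 2%N * f 2%N = 0) ->
  forall a, (a < 3)%N -> f a = 0.
Proof.
move=> d0 h a a3; have uq : mx3 q \in unitmx by rewrite unitmxE det_mx3 unitfE.
pose F : 'cV[R]_3 := \col_i f (val i).
have qF : mx3 q *m F = 0.
  apply/colP=> i; rewrite !mxE !big_ord_recl big_ord0 !mxE /= addr0 addrA.
  exact: h.
have : F = 0 by rewrite -(mulKmx uq F) qF mulmx0.
by move=> /(congr1 (fun M : 'cV_3 => M (Ordinal a3) 0)); rewrite !mxE.
Qed.

Lemma mixed_coef_eq0 : det3 p != 0 ->
  (forall i v, (i < 3)%N -> (v < 4)%N -> B3 c i.+4 v = 0) ->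
  forall i v, (i < 3)%N -> (v < 4)%N -> X i v = 0.
Proof.
move=> d0 h.
have hB v : (v < 4)%N -> forall a, (a < 3)%N -> Bpull a v = 0.
  move=> v4; apply: (mx3_ker d0) => i i3; have := h i v i3 v4; rewrite B3_mixed //.
  by move/eqP; rewrite mulf_eq0 pnatr_eq0 /= => /eqP.
have b00 := hB 0%N isT 0%N isT; have b10 := hB 0%N isT 1%N isT; have b20 := hB 0%N isT 2%N isT.
have b01 := hB 1%N isT 0%N isT; have b11 := hB 1%N isT 1%N isT; have b21 := hB 1%N isT 2%N isT.
have b02 := hB 2%N isT 0%N isT; have b12 := hB 2%N isT 1%N isT; have b22 := hB 2%N isT 2%N isT.
have b03 := hB 3%N isT 0%N isT; have b13 := hB 3%N isT 1%N isT; have b23 := hB 3%N isT 2%N isT.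
(* The twelve equations split into four invertible 3x3 systems, such as the one in Y 0 0, Y 1 3, Y 2
   2. *)
have hY a v : (a < 3)%N -> (v < 4)%N -> pullX a v = 0.
  move: b00 b10 b20 b01 b11 b21 b02 b12 b22 b03 b13 b23; cbv [Bpull]; move: pullX => Y.
  by case: a => [|[|[|]]] //; case: v => [|[|[|[|]]]] // *; lra.
have d0' : det3 (fun i j => p j i) != 0.
  by rewrite (_ : det3 _ = det3 p) // /det3 /cof3 /=; ring.
by move=> i v i3 v4; apply: (mx3_ker d0' (f := fun i => X i v)) i3 => a a3; apply: hY.
Qed.
End SelfDual.

(** Let a = (0, u, w) and b = (0, 0, y) be, up to a common factor, the self-dual parts of d z^4 and
    d z^5. Closedness ([d1], [d2], [d3]) and purity ([d4]) say that P b = (x, x', 0) and P a = (-x',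
    x, 0), a quarter turn of it. As P is a multiple of an orthogonal matrix, a and b are orthogonal
    of equal norm. *)
Lemma conformal_of_selfdual t p (e a02 a13 a03 a12 b03 b12 : R)
    (c := three_form t (fun _ _ => 0) p (fun _ _ => 0))
    (e1 := two_form a02 a13 a03 a12) (e2 := two_form 0 0 b03 b12) :
  e != 0 ->
  (forall i j, (i < 3)%N -> (j < 3)%N -> B3 c i.+4 j.+4 = 6%:R * ((i == j)%:R * e)) ->
  (forall l, l \in combs (iota 0 7) 5 -> form_d e1 e2 (star c) 3 l = 0) ->
  shuffle (iota 0 7) 4 3 (form_d e1 e2 c 2) (sorted_coef c) = 0 ->
  (a03 + a12) * (b03 + b12) = 0 /\
  (a02 - a13) ^+ 2 + (a03 + a12) ^+ 2 = (b03 + b12) ^+ 2.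
Proof.
move=> e0 hB hd hp.
have BE i j : (i < 3)%N -> (j < 3)%N -> B3 c i.+4 j.+4 =
    6%:R * (t * (p i 0%N * p j 0%N + p i 1%N * p j 1%N + p i 2%N * p j 2%N)).
  by case: i => [|[|[|]]] //; case: j => [|[|[|]]] // _ _;
    rewrite /B3 /c; expand; cbv [three_form]; ring.
have gram i j : (i < 3)%N -> (j < 3)%N ->
    t * (p i 0%N * p j 0%N + p i 1%N * p j 1%N + p i 2%N * p j 2%N) = (i == j)%:R * e.
  move=> i3 j3; have f6 : 6%:R != 0 :> R by rewrite pnatr_eq0.
  by apply: (mulfI f6); rewrite -BE // hB.
have t0 : t != 0.
  by apply: contra_neq e0 => t0; have := gram 0%N 0%N isT isT; rewrite t0 mul0r mul1r.
(* A right inverse of a square matrix is a left inverse, so orthogonality passes from the rows to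
   the columns. *)
have gramT i j : (i < 3)%N -> (j < 3)%N ->
    t * (p 0%N i * p 0%N j + p 1%N i * p 1%N j + p 2%N i * p 2%N j) = (i == j)%:R * e.
  move=> i3 j3.
  have M1 : mx3 p *m (t / e *: (mx3 p)^T) = 1%:M.
    apply/matrixP=> a b; rewrite !mxE !big_ord_recl big_ord0 !mxE /= addr0 -val_eqE /=.
    apply: (mulIf e0); rewrite -gram //; field; exact: e0.
  have := congr1 (fun M : 'M_3 => M (Ordinal i3) (Ordinal j3)) (mulmx1C M1).
  rewrite !mxE !big_ord_recl big_ord0 !mxE /= addr0 -val_eqE /= => <-.
  by field.
set u := a02 - a13; set w := a03 + a12; set y := b03 + b12.
have d1 : u * p 2%N 1%N + w * p 2%N 2%N = 0.
  have := hd [:: 0; 1; 2; 3; 5]%N isT.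
  rewrite /e1 /e2 /c; expand; cbv [two_form three_form]; rewrite /u /w => h; rewrite -[RHS]h; ring.
have d2 : y * p 2%N 2%N = 0.
  have := hd [:: 0; 1; 2; 3; 4]%N isT.
  rewrite /e1 /e2 /c; expand; cbv [two_form three_form]; rewrite /y => h.
  apply/eqP; rewrite -oppr_eq0 -h; apply/eqP; ring.
have d3 : u * p 1%N 1%N + w * p 1%N 2%N = y * p 0%N 2%N.
  have := hd [:: 0; 1; 2; 3; 6]%N isT.
  rewrite /e1 /e2 /c; expand; cbv [two_form three_form]; rewrite /y /u /w => h.
  apply/eqP; rewrite -subr_eq0 -oppr_eq0 -h; apply/eqP; ring.
have d4 : u * p 0%N 1%N + w * p 0%N 2%N = - (y * p 1%N 2%N).
  move: hp; rewrite /e1 /e2 /c; expand; cbv [two_form three_form]; rewrite /y /u /w => h.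
  have t2 : 2%:R * t != 0 by rewrite mulf_neq0 ?pnatr_eq0.
  apply: (mulfI t2); apply/eqP; rewrite -subr_eq0 -h; apply/eqP; ring.
have q11 := gramT 1%N 1%N isT isT; have q12 := gramT 1%N 2%N isT isT.
have q22 := gramT 2%N 2%N isT isT.
rewrite /= mul1r in q11 q22; rewrite /= mul0r in q12.
split; apply: (mulfI e0).
  rewrite mulr0 -{1}q22.
  transitivity (t * ((y * p 0%N 2%N) * (u * p 0%N 1%N + w * p 0%N 2%N) +
    (y * p 1%N 2%N) * (u * p 1%N 1%N + w * p 1%N 2%N) +
    (y * p 2%N 2%N) * (u * p 2%N 1%N + w * p 2%N 2%N)) -
    y * u * (t * (p 0%N 1%N * p 0%N 2%N + p 1%N 1%N * p 1%N 2%N + p 2%N 1%N * p 2%N 2%N))).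
    ring.
  rewrite q12 d1 d3 d4; ring.
transitivity (u ^+ 2 * e + w ^+ 2 * e + 2%:R * u * w * 0); first ring.
rewrite -{1}q11 -{1}q22 -q12 -{1}q22.
transitivity (t * ((u * p 0%N 1%N + w * p 0%N 2%N) ^+ 2 + (u * p 1%N 1%N + w * p 1%N 2%N) ^+ 2 +
  (u * p 2%N 1%N + w * p 2%N 2%N) ^+ 2)); first ring.
transitivity (t * ((y * p 0%N 2%N) ^+ 2 + (y * p 1%N 2%N) ^+ 2 + (y * p 2%N 2%N) ^+ 2)); last ring.
rewrite d1 d2 d3 d4; ring.
Qed.
End Algebra.

(** * Purely coclosed structures in an adapted frame *)

Ltac combs_cases k tac :=
  let M := eval vm_compute in (combs (iota 0 7) k) in
  rewrite (_ : combs (iota 0 7) k = M) //;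
  repeat (let l := fresh "l" in intro l; case/predU1P => [->|]; [tac | revert l]).

Section Split.
Variable R : realType.
Implicit Types (c : seq nat -> R).

Definition sd_part c (z j : nat) : R :=
  match j with
  | 0%N => (c [:: 0; 1; z.+4]%N + c [:: 2; 3; z.+4]%N) / 2%:R
  | 1%N => (c [:: 0; 2; z.+4]%N - c [:: 1; 3; z.+4]%N) / 2%:R
  | _ => (c [:: 0; 3; z.+4]%N + c [:: 1; 2; z.+4]%N) / 2%:R
  end.

Definition asd_part c (z j : nat) : R :=
  match j with
  | 0%N => (c [:: 0; 1; z.+4]%N - c [:: 2; 3; z.+4]%N) / 2%:R
  | 1%N => (c [:: 0; 2; z.+4]%N + c [:: 1; 3; z.+4]%N) / 2%:R
  | _ => (c [:: 0; 3; z.+4]%N - c [:: 1; 2; z.+4]%N) / 2%:R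
  end.

Definition mixed_part c (i v : nat) : R :=
  match i with
  | 0%N => c [:: v; 5; 6]%N
  | 1%N => - c [:: v; 4; 6]%N
  | _ => c [:: v; 4; 5]%N
  end.

(** The 35 coefficients are the four assumed to vanish and 1 + 12 + 18 others, the last 18 split
    into self-dual and anti-self-dual halves. *)
Lemma three_form_split c :
  c [:: 0; 1; 2]%N = 0 -> c [:: 0; 1; 3]%N = 0 -> c [:: 0; 2; 3]%N = 0 -> c [:: 1; 2; 3]%N = 0 ->
  forall l, l \in combs (iota 0 7) 3 ->
  c l = three_form (c [:: 4; 5; 6]%N) (mixed_part c) (sd_part c) (asd_part c) l.
Proof.
move=> h1 h2 h3 h4.
by combs_cases 3%N ltac:(cbv [three_form mixed_part sd_part asd_part]; clear -h1 h2 h3 h4;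
  first [done | by field | by rewrite opprK]).
Qed.

Lemma three_form_ext (t : R) (X X' p p' m m' : nat -> nat -> R) :
  (forall i v, (i < 3)%N -> (v < 4)%N -> X i v = X' i v) ->
  (forall i j, (i < 3)%N -> (j < 3)%N -> p i j = p' i j) ->
  (forall i j, (i < 3)%N -> (j < 3)%N -> m i j = m' i j) ->
  forall l, l \in combs (iota 0 7) 3 -> three_form t X p m l = three_form t X' p' m' l.
Proof.
move=> hX hp hm.
by combs_cases 3%N ltac:(by rewrite /three_form ?hX ?hp ?hm).
Qed.
End Split.

Section FrameLevel.
Variables (R : realType) (g : 'M[R]_7) (o : bool) (P : 'M[R]_7).
Hypotheses (Pg : P *m g *m P^T = 1%:M) (gI : inner_product g).
Notation x := (frame P).
Notation eps := (frame_vol g o P).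

Lemma frame_vol_neq0 : eps != 0.
Proof. by rewrite -sqrf_eq0 (frame_vol_sqr o Pg gI) oner_eq0. Qed.

Variables (br : 'rV[R]_7 -> 'rV[R]_7 -> 'rV[R]_7) (d1 d2 : kform R 7 2).
Variables (a02 a13 a03 a12 b03 b12 : R).
Hypothesis brE : forall u v, br u v = - (ev d1 [:: u; v] *: x 4 + ev d2 [:: u; v] *: x 5).
Hypotheses (h1 : alternating d1) (h2 : alternating d2).
Hypothesis he1 : forall m, m \in combs (iota 0 7) 2 -> coef x d1 m = two_form a02 a13 a03 a12 m.
Hypothesis he2 : forall m, m \in combs (iota 0 7) 2 -> coef x d2 m = two_form 0 0 b03 b12 m.

Section Forward.
Variable phi : kform R 7 3.
Hypotheses (hphi : alternating phi) (hcomp : G2_compatible phi (g, o)).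
Hypothesis hco : CE_diff br (@hodge R 3 4 g o phi) = 0.
Hypotheses (b03_neq0 : b03 != 0) (b12_neq0 : b12 != 0).
Notation c := (coef x phi).

(** Only d z^5 contributes to the components of d *phi with three indices in V followed by 4, 6.
    Each of those is, up to sign, [b03] or [b12] times one coefficient of phi on V. *)
Lemma coef_three_form : forall l, l \in combs (iota 0 7) 3 ->
  c l = three_form (c [:: 4; 5; 6]%N) (mixed_part c) (sd_part c) (asd_part c) l.
Proof.
have hd := (coclosed_frame (c := c) o Pg gI hphi (fun _ _ => erefl) brE h1 h2 he1 he2).1 hco.
apply: three_form_split.
- have := hd [:: 1; 2; 3; 4; 6]%N isT; expand; cbv [two_form]; move: c => c'.
  by rewrite !(mul0r, mulr0, oppr0, add0r, addr0); move/eqP;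
    rewrite ?oppr_eq0 mulf_eq0 ?oppr_eq0 ?(negbTE b03_neq0) ?(negbTE b12_neq0) => /eqP.
- have := hd [:: 0; 2; 3; 4; 6]%N isT; expand; cbv [two_form]; move: c => c'.
  by rewrite !(mul0r, mulr0, oppr0, add0r, addr0); move/eqP;
    rewrite ?oppr_eq0 mulf_eq0 ?oppr_eq0 ?(negbTE b03_neq0) ?(negbTE b12_neq0) => /eqP.
- have := hd [:: 0; 1; 3; 4; 6]%N isT; expand; cbv [two_form]; move: c => c'.
  by rewrite !(mul0r, mulr0, oppr0, add0r, addr0); move/eqP;
    rewrite ?oppr_eq0 mulf_eq0 ?oppr_eq0 ?(negbTE b03_neq0) ?(negbTE b12_neq0) => /eqP.
- have := hd [:: 0; 1; 2; 4; 6]%N isT; expand; cbv [two_form]; move: c => c'.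
  by rewrite !(mul0r, mulr0, oppr0, add0r, addr0); move/eqP;
    rewrite ?oppr_eq0 mulf_eq0 ?oppr_eq0 ?(negbTE b03_neq0) ?(negbTE b12_neq0) => /eqP.
Qed.

Lemma sd_or_asd :
  (forall i j, (i < 3)%N -> (j < 3)%N -> sd_part c i j = 0) \/
  (forall i j, (i < 3)%N -> (j < 3)%N -> asd_part c i j = 0).
Proof.
apply: (selfdual_or_antiselfdual (t := c [:: 4; 5; 6]%N) (X := mixed_part c) frame_vol_neq0).
exact: (compatible_frame Pg hphi coef_three_form hcomp).
Qed.

Lemma conformal_frame : wedge (CE_diff br phi) phi = 0 ->
  (forall i j, (i < 3)%N -> (j < 3)%N -> asd_part c i j = 0) ->
  (a03 + a12) * (b03 + b12) = 0 /\
  (a02 - a13) ^+ 2 + (a03 + a12) ^+ 2 = (b03 + b12) ^+ 2.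
Proof.
move=> hpure hasd; set t := c [:: 4; 5; 6]%N.
have hc1 l : l \in combs (iota 0 7) 3 ->
    c l = three_form t (mixed_part c) (sd_part c) (fun _ _ => 0) l.
  by move=> hl; rewrite coef_three_form //; apply: three_form_ext.
have hB1 := compatible_frame Pg hphi hc1 hcomp.
(* With M = 0, the trace of B on V gives det P = - [eps]. *)
have dp : det3 (sd_part c) != 0.
  have [_] := mixed_eq0 hB1; rewrite [det3 (fun _ _ => 0)](_ : _ = 0) ?addr0 => [->|].
    by rewrite oppr_eq0 frame_vol_neq0.
  by rewrite /det3 !mul0r !addr0.
have hX : forall i v, (i < 3)%N -> (v < 4)%N -> mixed_part c i v = 0.
  apply: (mixed_coef_eq0 (t := t) dp) => i v i3 v4; rewrite [LHS]hB1.
  - by case: eqP => [e|_]; [move: v4; rewrite -e | rewrite mul0r mulr0].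
  - by rewrite !ltnS.
  - exact: leq_trans v4 _.
have hc l : l \in combs (iota 0 7) 3 ->
    c l = three_form t (fun _ _ => 0) (sd_part c) (fun _ _ => 0) l.
  by move=> hl; rewrite hc1 //; apply: three_form_ext.
have hB := compatible_frame Pg hphi hc hcomp.
apply: (conformal_of_selfdual (t := t) (p := sd_part c) frame_vol_neq0).
- by move=> i j i3 j3; rewrite [LHS]hB ?ltnS // !eqSS.
- exact: (coclosed_frame o Pg gI hphi hc brE h1 h2 he1 he2).1 hco.
- exact: (pure_frame Pg hphi hc brE h1 h2 he1 he2).1 hpure.
Qed.
End Forward.

Section Reverse.
(** Of the solutions of w y = 0, u^2 + w^2 = y^2, only the branch w = 0, u = y is realised; the
    signs of the square roots in the frame are chosen to reach it. *)
Hypotheses (w0 : a03 + a12 = 0) (uy : a02 - a13 = b03 + b12).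

(** The columns of [invmx P] are the dual covectors of the frame, so this minor is the wedge product
    of three of them. *)
Definition dual_minor (f : 'I_3 -> 'I_7) : kform R 7 3 :=
  fun A => \det (A *m colsub f (invmx P)).

Lemma alternating_dual_minor f : alternating (dual_minor f).
Proof.
have [det_lin det_alt] := @alternating_det R 3; split=> [A B C i b c' eA eB eC|A i j ij eA].
  by apply: (det_lin _ _ _ i); rewrite ?row_mul ?eA ?mulmxDl -?scalemxAl // !row'Esub -!mul_rowsub_mx -!row'Esub ?eB ?eC.
by apply: (det_alt _ i j ij); rewrite !row_mul eA.
Qed.

Definition form_of (c : seq nat -> R) (ls : seq (seq nat)) : kform R 7 3 :=
  fun A => \sum_(l <- ls) c l * dual_minor (fun j => inord (nth 0%N l j)) A.

Lemma alternating_form_of c ls : alternating (form_of c ls).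
Proof.
by apply: alternating_sum => l; apply: alternatingZ; exact: alternating_dual_minor.
Qed.

Lemma coef_form_of c ls m : size m = 3 -> all (fun i => i < 7)%N m ->
  all (fun l => (size l == 3) && all (fun i => i < 7)%N l) ls ->
  coef x (form_of c ls) m =
  \sum_(l <- ls) c l * det3 (fun i j => (nat_of_bool (Nat.eqb (nth 0%N m i) (nth 0%N l j)))%:R).
Proof.
move=> sm lm hls; rewrite /coef /ev /form_of; apply: eq_big_seq => l ll; congr (_ * _).
have /andP[/eqP sl l7] := allP hls _ ll.
rewrite /dual_minor -det_mx3; congr (\det _); apply/matrixP=> i j.
have mi : (nth 0 m i < 7)%N by apply: (allP lm); rewrite mem_nth ?sm.
have lj : (nth 0 l j < 7)%N by apply: (allP l7); rewrite mem_nth ?sl.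
transitivity ((P *m invmx P) (inord (nth 0%N m i)) (inord (nth 0%N l j))).
  rewrite !mxE; apply: eq_bigr => a _; rewrite !mxE (nth_map 0%N) ?sm //.
  by rewrite /frame mxE.
rewrite mulmxV; last exact: (@frame_unit R 4 _ _ Pg).
by rewrite !mxE -val_eqE /= !inordK // eqbE.
Qed.

(* The self-dual triple is ordered so that the conditions on [d z^4] and [d z^5]
   become [w0] and [uy]; [e] fixes the orientation. *)
Definition std_part (e : R) (i j : nat) : R :=
  match i, j with
  | 0%N, 2%N => 1
  | 1%N, 1%N => 1
  | 2%N, 0%N => e
  | _, _ => 0
  end.

Definition std_coef (e : R) : seq nat -> R :=
  three_form e (fun _ _ => 0) (std_part e) (fun _ _ => 0).

Definition std_support : seq (seq nat) :=
  [:: [:: 4; 5; 6]; [:: 0; 3; 4]; [:: 1; 2; 4]; [:: 0; 2; 5]; [:: 1; 3; 5];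
      [:: 0; 1; 6]; [:: 2; 3; 6]]%N.

Definition std_phi : kform R 7 3 := form_of (std_coef eps) std_support.

Lemma coef_std_phi l : l \in combs (iota 0 7) 3 -> coef x std_phi l = std_coef eps l.
Proof.
move=> hl; have /andP[/eqP sl l7] : (size l == 3) && all (fun i => i < 7)%N l.
  by move: l hl; apply/allP; vm_compute.
rewrite coef_form_of // /std_support !big_cons big_nil /std_coef.
move: eps => e; move: l hl {sl l7}.
by combs_cases 3%N ltac:(cbv [three_form std_part det3 cof3 next3 Nat.eqb nth nat_of_bool]; ring).
Qed.

Lemma std_compatible : G2_compatible std_phi (g, o).
Proof.
apply: (frame_compatible Pg gI (alternating_form_of _ _) coef_std_phi) => v w.
have vE (a : nat -> R) c : (fun l => \sum_(i < 7) a i * sorted_coef c (val i :: l)) =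
  (fun l => a 0%N * sorted_coef c (0%N :: l) + a 1%N * sorted_coef c (1%N :: l) +
    a 2%N * sorted_coef c (2%N :: l) + a 3%N * sorted_coef c (3%N :: l) +
    a 4%N * sorted_coef c (4%N :: l) + a 5%N * sorted_coef c (5%N :: l) +
    a 6%N * sorted_coef c (6%N :: l)).
  by apply/funext => l; rewrite !big_ord_recr big_ord0 /= add0r.
rewrite !vE !big_ord_recr big_ord0 /= /std_coef.
(* B is cubic in phi and contains powers of [eps] that reduce to [eps] only because it is a sign. *)
have /eqP := frame_vol_sqr o Pg gI; rewrite sqrf_eq1 => /orP[] /eqP ->;
  expand; cbv [three_form std_part]; ring.
Qed.

Lemma exists_purely_coclosed : exists phi : kform R 7 3,
  [/\ G2_structure phi, purely_coclosed br phi & G2_metric phi = g].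
Proof.
have hc := std_compatible; have data := G2_data_eq hc.
have aphi : alternating std_phi by exact: alternating_form_of.
exists std_phi; split; last by rewrite /G2_metric data.
  exact: (compatible_G2 Pg gI aphi hc).
have a12E : a12 = - a03 by apply/eqP; rewrite -addr_eq0 addrC w0.
have a02E : a02 = a13 + b03 + b12 by rewrite -addrA -uy addrC subrK.
split.
  rewrite /G2_hodge data /=.
  apply/(coclosed_frame o Pg gI aphi coef_std_phi brE h1 h2 he1 he2).
  rewrite a12E a02E; move: eps => e.
  by combs_cases 5%N ltac:(expand; cbv [two_form three_form std_coef std_part]; ring).
apply/(pure_frame Pg aphi coef_std_phi brE h1 h2 he1 he2).
rewrite a12E a02E; move: eps => e.
expand; cbv [two_form three_form std_coef std_part]; ring.
Qed.
End Reverse.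
End FrameLevel.

Lemma ev_opp (R : realType) n k (alpha : kform R n k) l1 l2 v : alternating alpha ->
  (size l1 + size l2).+1 = k -> ev alpha (l1 ++ (- v) :: l2) = - ev alpha (l1 ++ v :: l2).
Proof. by move=> ha sz; rewrite -scaleN1r ev_scale // mulN1r. Qed.

Lemma asd_part_flip (R : realType) (P P' : 'M[R]_7) (phi : kform R 7 3) :
  alternating phi -> frame P' 1 = - frame P 1 ->
  (forall i, i != 1%N -> frame P' i = frame P i) ->
  (forall i j, (i < 3)%N -> (j < 3)%N -> sd_part (coef (frame P) phi) i j = 0) ->
  forall i j, (i < 3)%N -> (j < 3)%N -> asd_part (coef (frame P') phi) i j = 0.
Proof.
move=> hphi f1 f hsd i j i3 j3; have := hsd i j i3 j3.
rewrite /sd_part /asd_part /coef /=; case: j {j3} => [|[|j]].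
- rewrite f1 !f // (ev_opp (l1 := [:: _]) _ hphi) //=; lra.
- rewrite f1 !f // (ev_opp (l1 := [::]) _ hphi) //=; lra.
- rewrite f1 !f // (ev_opp (l1 := [::]) _ hphi) //=; lra.
Qed.

(** * The frame of h_3^C + R *)

Lemma inner_product_of_frame (R : realType) n (g P : 'M[R]_n) :
  g^T = g -> P *m g *m P^T = 1%:M -> inner_product g.
Proof.
move=> gT Pg; split=> // v v0.
have uP : P \in unitmx by move: Pg; rewrite -mulmxA => /mulmx1_unit [].
have [w vE] : exists w, v = w *m P by exists (v *m invmx P); rewrite mulmxKV.
have w0 : w != 0 by apply: contra_neq v0 => w0; rewrite vE w0 mul0mx.
rewrite /ip vE trmx_mul !mulmxA -(mulmxA w) -(mulmxA w) Pg mulmx1 lt0r.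
have -> : (w *m w^T) 0 0 = \sum_i w 0 i ^+ 2.
  by rewrite mxE; apply: eq_bigr => i _; rewrite mxE -expr2.
rewrite sumr_ge0 ?andbT => [|i _]; last exact: sqr_ge0.
apply: contra_neq w0 => /eqP; rewrite psumr_eq0 => [/allP h|i _]; last exact: sqr_ge0.
by apply/rowP=> i; rewrite mxE; have := h i (mem_index_enum i); rewrite /= sqrf_eq0 => /eqP.
Qed.

(* The square roots [rho], [sigma], [h], [k] may have either sign: replacing [rho] by
   [- rho] reverses [x_1]. *)
Section Concrete.
Variables (R : realType) (r s E F G rho sigma h k : R).
Hypotheses (hrho : rho ^+ 2 = r) (hsigma : sigma ^+ 2 = s) (hh : h ^+ 2 = E)
  (hk : k ^+ 2 * E = E * G - F ^+ 2).
Hypotheses (rho0 : rho != 0) (sigma0 : sigma != 0) (h0 : h != 0) (k0 : k != 0).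

Definition metric_entry (i j : nat) : R :=
  match i, j with
  | 0%N, 0%N => 1 | 1%N, 1%N => r | 2%N, 2%N => 1 | 3%N, 3%N => s
  | 4%N, 4%N => E | 4%N, 5%N => F | 5%N, 4%N => F | 5%N, 5%N => G | 6%N, 6%N => 1
  | _, _ => 0
  end.

(** Gram-Schmidt: x_4 = e_5 / h and x_5 = (e_6 - (F / E) e_5) / k, with k^2 = G - F^2 / E. *)
Definition frame_entry (i j : nat) : R :=
  match i, j with
  | 0%N, 0%N => 1 | 1%N, 1%N => rho^-1 | 2%N, 2%N => 1 | 3%N, 3%N => sigma^-1
  | 4%N, 4%N => h^-1 | 5%N, 4%N => - (F / h ^+ 2) / k | 5%N, 5%N => k^-1 | 6%N, 6%N => 1
  | _, _ => 0
  end.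

Definition frame_mx : 'M[R]_7 := \matrix_(i, j) frame_entry (val i) (val j).

Lemma metric_mxE : h3C_R_metric r s E F G = \matrix_(i, j) metric_entry (val i) (val j).
Proof.
apply/matrixP=> i j; rewrite /h3C_R_metric /sym_prod !mxE -!val_eqE /= !inordK //.
by case: i => [[|[|[|[|[|[|[|]]]]]]] //= ?]; case: j => [[|[|[|[|[|[|[|]]]]]]] //= ?]; field.
Qed.

Lemma frame_mx_orthonormal : frame_mx *m h3C_R_metric r s E F G *m frame_mx^T = 1%:M.
Proof.
rewrite metric_mxE; apply/matrixP=> i j.
pose f i j := \sum_(l < 7) (\sum_(m < 7) frame_entry i (val m) * metric_entry (val m) (val l)) * frame_entry j (val l).
transitivity (f (val i) (val j)).
  by rewrite !mxE; apply: eq_bigr => l _; rewrite !mxE; congr (_ * _); apply: eq_bigr => m _; rewrite !mxE.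
rewrite !mxE -val_eqE /f !big_ord_recr !big_ord0 /=.
have hkG : G = (k ^+ 2 * h ^+ 2 + F ^+ 2) / h ^+ 2.
  by rewrite hh hk addrNK mulrC mulKf // -hh expf_neq0.
case: i => [[|[|[|[|[|[|[|]]]]]]] //= ?]; case: j => [[|[|[|[|[|[|[|]]]]]]] //= ?];
 cbv [frame_entry metric_entry]; rewrite -?hrho -?hsigma -?hh ?hkG; field; rewrite ?rho0 ?sigma0 ?h0 ?k0 //.
Qed.

Lemma inner_product_metric : inner_product (h3C_R_metric r s E F G).
Proof.
apply: inner_product_of_frame frame_mx_orthonormal.
rewrite metric_mxE; apply/matrixP=> i j; rewrite !mxE.
by case: i => [[|[|[|[|[|[|[|]]]]]]] //= ?]; case: j => [[|[|[|[|[|[|[|]]]]]]] //= ?].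
Qed.

Notation x := (frame frame_mx).
Notation df5 := (@dual_basis2 R 1 3 - @dual_basis2 R 2 4 : kform R 7 2).
Notation df6 := (@dual_basis2 R 1 4 + @dual_basis2 R 2 3 : kform R 7 2).

(** The dual covectors are z^4 = h (f^5 + (F / E) f^6) and z^5 = k f^6. *)
Definition d_frame4 : kform R 7 2 := (fun A => h * df5 A) + (fun A => h * (F / h ^+ 2) * df6 A).
Definition d_frame5 : kform R 7 2 := fun A => k * df6 A.

Lemma alternating_dual_basis2 i j : alternating (@dual_basis2 R i j).
Proof.
by apply: (@alternating_wedge _ _ 1 1); apply: alternating_linear => b c u v; rewrite /dual_basis !mxE.
Qed.

Lemma alternating_d_frame4 : alternating d_frame4.
Proof.
apply: alternatingD; apply: alternatingZ.
  by apply: alternatingB; exact: alternating_dual_basis2.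
by apply: alternatingD; exact: alternating_dual_basis2.
Qed.

Lemma alternating_d_frame5 : alternating d_frame5.
Proof. by apply: alternatingZ; apply: alternatingD; exact: alternating_dual_basis2. Qed.

Lemma ev_dual_basis2 i j (u v : 'rV[R]_7) :
  ev (@dual_basis2 R i j) [:: u; v] =
  u 0 (inord i.-1) * v 0 (inord j.-1) - v 0 (inord i.-1) * u 0 (inord j.-1).
Proof. by rewrite /ev /dual_basis2 wedge11E !row_rows. Qed.

Lemma ev_d_frame4 u v : ev d_frame4 [:: u; v] =
  h * (ev (@dual_basis2 R 1 3) [:: u; v] - ev (@dual_basis2 R 2 4) [:: u; v]) +
  h * (F / h ^+ 2) * (ev (@dual_basis2 R 1 4) [:: u; v] + ev (@dual_basis2 R 2 3) [:: u; v]).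
Proof. by []. Qed.

Lemma ev_d_frame5 u v : ev d_frame5 [:: u; v] =
  k * (ev (@dual_basis2 R 1 4) [:: u; v] + ev (@dual_basis2 R 2 3) [:: u; v]).
Proof. by []. Qed.

Lemma frame_entryE i j : (i < 7)%N -> (j < 7)%N -> x i 0 (inord j) = frame_entry i j.
Proof. by move=> i7 j7; rewrite !mxE /= !inordK. Qed.

Lemma bracket_frame u v :
  h3C_R u v = - (ev d_frame4 [:: u; v] *: x 4 + ev d_frame5 [:: u; v] *: x 5).
Proof.
rewrite h3C_RE ev_d_frame4 ev_d_frame5 !ev_dual_basis2 /=.
set A := _ - _ - (_ - _); set B := _ - _ + (_ - _); move: A B => A B.
apply/rowP=> j; rewrite !mxE -!val_eqE /= !inordK //.
by case: j => [[|[|[|[|[|[|[|]]]]]]] //= ?]; rewrite /frame_entry; field; rewrite ?h0 ?k0.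
Qed.

Definition slope := F / h ^+ 2.

Lemma coef_d_frame4 m : m \in combs (iota 0 7) 2 ->
  coef x d_frame4 m = two_form h (- (h / (rho * sigma))) (h * slope / sigma) (h * slope / rho) m.
Proof.
move: m; by combs_cases 2%N ltac:(rewrite /coef [map _ _]/= ev_d_frame4 !ev_dual_basis2 !frame_entryE //; cbv [frame_entry two_form slope predn];
  field; rewrite ?rho0 ?sigma0 ?h0 //).
Qed.

Lemma coef_d_frame5 m : m \in combs (iota 0 7) 2 ->
  coef x d_frame5 m = two_form 0 0 (k / sigma) (k / rho) m.
Proof.
move: m; by combs_cases 2%N ltac:(rewrite /coef [map _ _]/= ev_d_frame5 !ev_dual_basis2 !frame_entryE //; cbv [frame_entry two_form slope predn];
  field; rewrite ?rho0 ?sigma0 //).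
Qed.

End Concrete.

(** * From the self-dual parts to conditions on the metric *)

Section Conformal.
Variables (R : realType) (r s E F G rho sigma h k : R).
Hypotheses (hrho : rho ^+ 2 = r) (hsigma : sigma ^+ 2 = s) (hh : h ^+ 2 = E)
  (hk : k ^+ 2 * E = E * G - F ^+ 2).
Hypotheses (rho0 : rho != 0) (sigma0 : sigma != 0) (h0 : h != 0) (k0 : k != 0).
Notation g := (h3C_R_metric r s E F G).
Notation P := (frame_mx F rho sigma h k).

(** Here u = h (1 + 1/(rho sigma)), w = h (F / E) (1/rho + 1/sigma) and y = k (1/rho + 1/sigma). The
    conclusion is w y = 0 and u^2 + w^2 = y^2 with denominators cleared. *)
Lemma conformal_metric o (phi : kform R 7 3) : alternating phi ->
  G2_compatible phi (g, o) -> CE_diff (@h3C_R R) (@hodge R 3 4 g o phi) = 0 ->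
  wedge (CE_diff (@h3C_R R) phi) phi = 0 ->
  (forall i j, (i < 3)%N -> (j < 3)%N -> asd_part (coef (frame P) phi) i j = 0) ->
  [/\ (rho + sigma) ^+ 2 * F = 0 &
      E * (rho * sigma + 1) ^+ 2 + (F * (rho + sigma)) ^+ 2 / E = k ^+ 2 * (rho + sigma) ^+ 2].
Proof.
move=> hphi hcomp hco hpure hasd.
have [] := conformal_frame (frame_mx_orthonormal hrho hsigma hh hk rho0 sigma0 h0 k0)
  (inner_product_metric hrho hsigma hh hk rho0 sigma0 h0 k0) (bracket_frame F rho sigma h0 k0)
  (alternating_d_frame4 F h) (alternating_d_frame5 k)
  (coef_d_frame4 F k rho0 sigma0 h0) (coef_d_frame5 F h k rho0 sigma0)
  hphi hcomp hco _ _ hpure hasd.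
- by rewrite mulf_neq0 // invr_neq0.
- by rewrite mulf_neq0 // invr_neq0.
rewrite /slope => e1 e2; split.
  have c0 : k / (h * (rho * sigma) ^+ 2) != 0.
    by rewrite mulf_neq0 // invr_neq0 // mulf_neq0 // expf_neq0 // mulf_neq0.
  by apply: (mulfI c0); rewrite mulr0 -e1; field; rewrite ?h0 ?rho0 ?sigma0.
have c0 : ((rho * sigma) ^+ 2)^-1 != 0 by rewrite invr_neq0 // expf_neq0 // mulf_neq0.
apply: (mulfI c0); transitivity ((k / sigma + k / rho) ^+ 2).
  by rewrite -e2 -hh; field; rewrite ?h0 ?rho0 ?sigma0.
by field; rewrite ?rho0 ?sigma0.
Qed.

Lemma sd_or_asd_metric o (phi : kform R 7 3) : alternating phi ->
  G2_compatible phi (g, o) -> CE_diff (@h3C_R R) (@hodge R 3 4 g o phi) = 0 ->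
  (forall i j, (i < 3)%N -> (j < 3)%N -> sd_part (coef (frame P) phi) i j = 0) \/
  (forall i j, (i < 3)%N -> (j < 3)%N -> asd_part (coef (frame P) phi) i j = 0).
Proof.
move=> hphi hcomp hco.
apply: (sd_or_asd (frame_mx_orthonormal hrho hsigma hh hk rho0 sigma0 h0 k0)
  (inner_product_metric hrho hsigma hh hk rho0 sigma0 h0 k0) (bracket_frame F rho sigma h0 k0)
  (alternating_d_frame4 F h) (alternating_d_frame5 k)
  (coef_d_frame4 F k rho0 sigma0 h0) (coef_d_frame5 F h k rho0 sigma0)
  hphi hcomp hco).
- by rewrite mulf_neq0 // invr_neq0.
- by rewrite mulf_neq0 // invr_neq0.
Qed.

Lemma exists_on_metric :
  (rho + sigma) * F = 0 -> h * (rho * sigma + 1) = k * (rho + sigma) ->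
  exists phi : kform R 7 3,
    [/\ G2_structure phi, purely_coclosed (@h3C_R R) phi & G2_metric phi = g].
Proof.
move=> e1 e2.
apply: (exists_purely_coclosed false (frame_mx_orthonormal hrho hsigma hh hk rho0 sigma0 h0 k0)
  (inner_product_metric hrho hsigma hh hk rho0 sigma0 h0 k0) (bracket_frame F rho sigma h0 k0)
  (alternating_d_frame4 F h) (alternating_d_frame5 k)
  (coef_d_frame4 F k rho0 sigma0 h0) (coef_d_frame5 F h k rho0 sigma0)).
  transitivity (((rho + sigma) * F) / (h * (rho * sigma))); last by rewrite e1 mul0r.
  by rewrite /slope; field; rewrite ?h0 ?rho0 ?sigma0.
transitivity ((h * (rho * sigma + 1)) / (rho * sigma)); first by field; rewrite ?h0 ?rho0 ?sigma0.
by rewrite e2; field; rewrite ?h0 ?rho0 ?sigma0.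
Qed.
End Conformal.

(** Without a compatible pair, [G2_data] would return its default, whose zero matrix differs from
    the metric in the first diagonal entry. *)
Lemma G2_compatible_of_metric (R : realType) (phi : kform R 7 3) (r s E F G : R) :
  G2_metric phi = h3C_R_metric r s E F G ->
  G2_data phi = (h3C_R_metric r s E F G, (G2_data phi).2) /\ G2_compatible phi (G2_data phi).
Proof.
move=> gE; split; first by rewrite -gE /G2_metric; case: (G2_data phi).
have [[go hgo]|no] := pselect (exists go, G2_compatible phi go).
  by rewrite (G2_data_eq hgo).
have : G2_data phi = (0, false).
  by rewrite /G2_data; apply: xgetPN => go hgo; apply: no; exists go.
move=> d; move: gE; rewrite /G2_metric d metric_mxE => /matrixP /(_ 0 0).
by rewrite !mxE /= => /eqP; rewrite eq_sym oner_eq0.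
Qed.

Theorem proposition5p5 (R : realType) (r s E F G : R)
    (hs : 0 < s) (hsr : s <= r) (hr : r <= 1)
    (hE : 0 <= E) (hF : 0 <= F) (hG : 0 <= G) (hEFG : 0 < E * G - F ^+ 2) :
  (exists phi : kform R 7 3,
      [/\ G2_structure phi,
          purely_coclosed (@h3C_R R) phi &
          G2_metric phi = h3C_R_metric r s E F G])
  <->
  [\/ r = 1 /\ s = 1,
      [/\ 0 < r, r = s, s < 1, F = 0 &
          G = E * ((Num.sqrt (r * s) + 1) / (Num.sqrt r + Num.sqrt s)) ^+ 2] |
      [/\ 0 < s, s < r, r <= 1, F = 0 &
          G = E * ((Num.sqrt (r * s) + 1) / (Num.sqrt r + Num.sqrt s)) ^+ 2 \/
          G = E * ((Num.sqrt (r * s) - 1) / (Num.sqrt r - Num.sqrt s)) ^+ 2]].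
Proof.
have r_gt0 : 0 < r by exact: lt_le_trans hsr.
have E_gt0 : 0 < E.
  rewrite lt0r hE andbT; apply: contraTneq hEFG => ->.
  by rewrite mul0r sub0r oppr_gt0 -leNgt sqr_ge0.
have G_neq0 : G != 0.
  by apply: contraTneq hEFG => ->; rewrite mulr0 sub0r oppr_gt0 -leNgt sqr_ge0.
have rho_gt0 : 0 < Num.sqrt r by rewrite sqrtr_gt0.
have sigma_gt0 : 0 < Num.sqrt s by rewrite sqrtr_gt0.
have rho2 : Num.sqrt r ^+ 2 = r by rewrite sqr_sqrtr // ltW.
have sigma2 : Num.sqrt s ^+ 2 = s by rewrite sqr_sqrtr // ltW.
rewrite sqrtrM ?(ltW r_gt0) //.
set rho := Num.sqrt r in rho_gt0 rho2 *; set sigma := Num.sqrt s in sigma_gt0 sigma2 *.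
have rho0 : rho != 0 by rewrite gt_eqF.
have sigma0 : sigma != 0 by rewrite gt_eqF.
have rhoN2 : (- rho) ^+ 2 = r by rewrite sqrrN.
have rhoN0 : - rho != 0 by rewrite oppr_eq0.
pose h := Num.sqrt E; have h2 : h ^+ 2 = E by rewrite sqr_sqrtr.
have h0 : h != 0 by rewrite gt_eqF // sqrtr_gt0.
have E0 : E != 0 by rewrite gt_eqF.
pose k := Num.sqrt ((E * G - F ^+ 2) / E).
have D_gt0 : 0 < (E * G - F ^+ 2) / E by rewrite divr_gt0.
have k2 : k ^+ 2 * E = E * G - F ^+ 2 by rewrite sqr_sqrtr ?ltW // divfK.
have k0 : k != 0 by rewrite gt_eqF // sqrtr_gt0.
have solve (t : R) : t + sigma != 0 -> (t + sigma) ^+ 2 * F = 0 ->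
    E * (t * sigma + 1) ^+ 2 + (F * (t + sigma)) ^+ 2 / E = k ^+ 2 * (t + sigma) ^+ 2 ->
    F = 0 /\ G = E * ((t * sigma + 1) / (t + sigma)) ^+ 2.
  move=> ts0 /eqP; rewrite mulf_eq0 expf_eq0 (negbTE ts0) /= => /eqP F0.
  rewrite F0 mul0r expr0n mul0r addr0 => e; split=> //.
  have kG : k ^+ 2 = G by apply: (mulIf E0); rewrite k2 F0 expr0n subr0 mulrC.
  rewrite expr_div_n mulrA e kG mulfK // expf_neq0 //.
have build (t : R) : t ^+ 2 = r -> t != 0 -> t + sigma != 0 -> F = 0 ->
    G = E * ((t * sigma + 1) / (t + sigma)) ^+ 2 ->
    exists phi : kform R 7 3,
    [/\ G2_structure phi, purely_coclosed (@h3C_R R) phi &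
        G2_metric phi = h3C_R_metric r s E F G].
  move=> t2 t0 ts0 F0 GE.
  have q0 : (t * sigma + 1) / (t + sigma) != 0.
    by apply: contra_neq G_neq0 => q; rewrite GE q expr0n mulr0.
  (* This k solves the equation u = y exactly; it may be negative when [t] is [- rho]. *)
  apply: (@exists_on_metric R r s E F G t sigma h (h * ((t * sigma + 1) / (t + sigma)))) => //.
  - by rewrite F0 exprMn h2 [in RHS]GE expr0n subr0; ring.
  - by rewrite mulf_neq0.
  - by rewrite F0 mulr0.
  - by rewrite -mulrA divfK.
(* The second ratio of the theorem is the first with [- rho] for [rho]. *)
have diffE : (rho * sigma - 1) / (rho - sigma) = (- rho * sigma + 1) / (- rho + sigma).
  rewrite -(opprB sigma rho) invrN mulrN -mulNr opprB; congr (_ / _); ring.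
split.
  move=> [phi [[hphi _] [hco hpure] /G2_compatible_of_metric [data hcomp]]].
  move: hco; rewrite /G2_hodge; move: data hcomp => -> /=; move: (G2_data phi).2 => o hcomp hco.
  have conf (t : R) : t ^+ 2 = r -> t != 0 ->
      (forall i j, (i < 3)%N -> (j < 3)%N ->
         asd_part (coef (frame (frame_mx F t sigma h k)) phi) i j = 0) ->
      (t + sigma) ^+ 2 * F = 0 /\
      E * (t * sigma + 1) ^+ 2 + (F * (t + sigma)) ^+ 2 / E = k ^+ 2 * (t + sigma) ^+ 2.
    by move=> t2 t0 /(conformal_metric t2 sigma2 h2 k2 t0 sigma0 h0 k0 hphi hcomp hco hpure) [].
  case: (sd_or_asd_metric rho2 sigma2 h2 k2 rho0 sigma0 h0 k0 hphi hcomp hco) => hpart.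
    (* Passing to [- rho] reverses x_1, so vanishing self-dual parts become vanishing anti-self-dual
       parts. *)
    have {}hpart : forall i j, (i < 3)%N -> (j < 3)%N ->
        asd_part (coef (frame (frame_mx F (- rho) sigma h k)) phi) i j = 0.
      apply: (asd_part_flip hphi _ _ hpart).
        apply/rowP=> j; rewrite !mxE /= !inordK //.
        by case: j => [[|[|[|[|[|[|[|]]]]]]] //= ?]; rewrite ?oppr0 ?invrN.
      move=> i i1; apply/rowP=> j; rewrite !mxE /=.
      have : nat_of_ord (inord i : 'I_7) != 1%N.
        by apply: contra_neq i1; rewrite /inord /insubd; case: insubP => [u _ /= -> |].
      by move: (nat_of_ord (inord i)) => [|[|[|[|[|[|[|]]]]]]].
    have [e1 e2] := conf _ rhoN2 rhoN0 hpart.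
    (* When the sum vanishes, F and G drop out of both equations and only E (1 - rho sigma)^2 = 0
       remains, which gives r = s = 1. *)
    have [ts|ts] := eqVneq (- rho + sigma) 0.
      have rs : rho = sigma by lra.
      move: e2; rewrite ts !mulr0 expr0n mul0r addr0 mulr0 => /eqP.
      rewrite mulf_eq0 (negbTE E0) sqrf_eq0 /= -rs => /eqP rr.
      by constructor 1; rewrite -rho2 -sigma2 -rs; split; lra.
    have [F0 GE] := solve _ ts e1 e2.
    constructor 3; split=> //; last by right; rewrite diffE.
    rewrite lt_neqAle hsr andbT; apply: contra_neq ts => rs.
    by rewrite /rho /sigma rs addNr.
  have [e1 e2] := conf _ rho2 rho0 hpart.
  have ts : rho + sigma != 0 by rewrite gt_eqF // addr_gt0.
  have [F0 GE] := solve _ ts e1 e2.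
  have [rs|rs] := eqVneq s r; last first.
    by constructor 3; split=> //; [rewrite lt_neqAle rs | left].
  have [r1|r1] := eqVneq r 1; first by constructor 1; rewrite rs.
  by constructor 2; split=> //; rewrite rs lt_neqAle r1.
have ts : rho + sigma != 0 by rewrite gt_eqF // addr_gt0.
case=> [[r1 s1]|[_ rs s1 F0 GE]|[_ sr _ F0 [GE|GE]]].
(* With - rho = -1 and sigma = 1 both requirements read 0 = 0, so E, F, G are unrestricted. *)
- have rho1 : rho = 1 by rewrite /rho r1 sqrtr1.
  have sigma1 : sigma = 1 by rewrite /sigma s1 sqrtr1.
  apply: (exists_on_metric rhoN2 sigma2 h2 k2) => //; rewrite rho1 sigma1; ring.
- exact: build GE.
- exact: build GE.
- apply: (build (- rho)) => //; last by rewrite -diffE.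
  by rewrite addrC subr_eq0 lt_eqF // /rho /sigma ltr_sqrt.
Qed.
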